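(* Let $G$ be a bridgeless graph in $\mathcal{G}_{n,n+k}$, where $n\ge1$ and $k\ge1$. \begin{enumerate} \item[(a)] $G$ has a weak distillation in $\mathcal{D}_k$ if and only if all 2-bonds of $G$ are trivial. \item[(b)] $G$ is equivalent to some graph $G^\dagger$ which has a weak distillation $D\in\mathcal{D}_k$. \item[(c)] If $G$ does not have a weak distillation in $\mathcal{D}_k$, then any graph $G^\dagger$ that is equivalent to $G$ and has a weak distillation in $\mathcal{D}_k$ is imbalanced and has at least one zero chain with respect to its weak distillation(s) in $\mathcal{D}_k$. \end{enumerate}
   Context: Graphs are finite connected multigraphs (multiple edges and loops allowed), considered up to isomorphism. $\mathcal{G}_{n,m}$ is the set of connected graphs with $n$ vertices and $m$ edges. $\mathcal{D}_k$ is the set of 3-edge-connected cubic graphs with $2k$ vertices and $3k$ edges (for $k=1$ this is the graph with two vertices joined by three edges). Weak distillation: for cubic $D$, $G$ is a weak subdivision of $D$ (equivalently, $D$ is a weak distillation of $G$) if $G$ can be obtained by assigning to each edge $e$ of $D$ a nonnegative integer weight $\ell(e)$ such that every cycle of $D$ has positive total weight, contracting each edge of weight $0$, and replacing each edge of weight $\ell\ge1$ by a path with $\ell$ edges. The weights are the chain lengths of $G$ relative to $D$; a chain of length $0$ is a zero chain. $G$ is balanced with respect to $D$ if its chain lengths (including zeros) pairwise differ by at most one, and imbalanced otherwise. Bonds: a cut is the set of edges crossing a partition of the vertices into two nonempty sets; a bond is a minimal cut; an $s$-bond is a bond with $s$ edges. A positive chain of $G$ is a maximal path with at least one edge all of whose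 internal vertices have degree 2 (the endvertices are not considered part of the chain and may coincide); every edge lies in exactly one positive chain. A 2-bond is trivial if its two edges belong to the same positive chain. Expanding an edge at a vertex $v$ means replacing $v$ by two adjacent vertices $v_1,v_2$, joined by the new edge, and assigning each incidence with $v$ to either $v_1$ or $v_2$ (a loop at $v$ becomes a loop at $v_1$ or $v_2$ or an additional edge between $v_1$ and $v_2$). Contracting a non-loop edge means removing it and merging its endvertices. An edge $e$ is shifted to a vertex $v$ by first expanding an edge $e'$ at $v$ in such a way that $\{e,e'\}$ is a 2-bond, and then contracting $e$. Two graphs are equivalent if one can be obtained from the other by repeated edge shifting. *)

(* Defs.v *)
From mathcomp Require Import all_boot.

Set Implicit Arguments.
Unset Strict Implicit.
Unset Printing Implicit Defensive.

(* Finite multigraphs.  An edge [e] has two ends, indexed by a boolean; the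
   indexing carries no orientation (isomorphisms may swap it).  A loop has two
   equal ends, so that the incidences of edges with vertices are exactly the
   half-edges [(e, i)]. *)
Record mgraph := MGraph {
  vert : finType;
  edge : finType;
  endv : edge -> bool -> vert }.

Definition halfedge (G : mgraph) : finType := (edge G * bool)%type.

(* A half-edge, read as a traversal of its edge, goes from [hsrc] to [htgt]. *)
Definition hsrc (G : mgraph) (h : halfedge G) : vert G := endv h.1 h.2.
Definition htgt (G : mgraph) (h : halfedge G) : vert G := endv h.1 (~~ h.2).

Definition iso (G H : mgraph) : Prop :=
  exists (f : vert G -> vert H) (g : edge G -> edge H),
    [/\ bijective f, bijective g &
        forall e, exists b, forall i, f (endv e i) = endv (g e) (b (+) i)].

Definition deg (G : mgraph) (v : vert G) : nat := #|[set h : halfedge G | hsrc h == v]|.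

Definition link (G : mgraph) (F : {set edge G}) : rel (vert G) :=
  fun x y => [exists h : halfedge G, [&& h.1 \in F, hsrc h == x & htgt h == y]].

Definition connected (G : mgraph) : bool :=
  (0 < #|vert G|) && [forall x, forall y, connect (link [set: edge G]) x y].

Definition delete (G : mgraph) (F : {set edge G}) : mgraph :=
  @MGraph (vert G) {e : edge G | e \notin F} (fun e => endv (val e)).

Definition bridgeless (G : mgraph) : Prop :=
  forall e : edge G, connected (delete [set e]).

Definition edge_connected (s : nat) (G : mgraph) : Prop :=
  forall F : {set edge G}, #|F| < s -> connected (delete F).

Definition in_Gnm (n m : nat) (G : mgraph) : Prop :=
  [/\ connected G, #|vert G| = n & #|edge G| = m].

Definition cubic (G : mgraph) : Prop := forall v : vert G, deg v = 3.

Definition in_Dk (k : nat) (D : mgraph) : Prop :=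
  [/\ cubic D, edge_connected 3 D, #|vert D| = 2 * k & #|edge D| = 3 * k].

Definition crossing (G : mgraph) (X : {set vert G}) : {set edge G} :=
  [set e | (endv e false \in X) != (endv e true \in X)].

Definition cut (G : mgraph) (C : {set edge G}) : bool :=
  [exists X : {set vert G}, [&& X != set0, X != setT & C == crossing X]].

Definition bond (G : mgraph) (C : {set edge G}) : bool := minset (@cut G) C.

Definition sbond (G : mgraph) (s : nat) (C : {set edge G}) : bool :=
  bond C && (#|C| == s).

Definition consec (G : mgraph) : rel (halfedge G) := fun h h' => htgt h == hsrc h'.

(* Loops are cycles of length 1, pairs of parallel edges cycles of length 2. *)
Definition is_cycle (G : mgraph) (c : seq (halfedge G)) : bool :=
  [&& c != [::], cycle (@consec G) c,
      uniq [seq h.1 | h <- c] & uniq [seq hsrc h | h <- c]].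

(* Walks v_0 ... v_l with l >= 1, without repeated edges, with v_0, ..., v_(l-1)
   distinct and v_1, ..., v_l distinct (so only v_0 = v_l is allowed), and with
   v_1, ..., v_(l-1) of degree 2. *)
Definition chain_path (G : mgraph) (p : seq (halfedge G)) : bool :=
  [&& p != [::], sorted (@consec G) p, uniq [seq h.1 | h <- p],
      uniq [seq hsrc h | h <- p], uniq [seq htgt h | h <- p] &
      all (fun h => deg (hsrc h) == 2) (behead p)].

Definition chain_edges (G : mgraph) (C : {set edge G}) : Prop :=
  exists2 p : seq (halfedge G), chain_path p & C = [set e | e \in [seq h.1 | h <- p]].

(* A positive chain is represented by its set of edges. *)
Definition positive_chain (G : mgraph) (C : {set edge G}) : Prop :=
  chain_edges C /\
  forall C' : {set edge G}, chain_edges C' -> C \subset C' -> C' = C.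

Definition trivial_2bond (G : mgraph) (B : {set edge G}) : Prop :=
  exists2 C : {set edge G}, positive_chain C & B \subset C.

Lemma link_sym (G : mgraph) (F : {set edge G}) : symmetric (link F).
Proof.
move=> x y; apply/existsP/existsP => -[[e i] /and3P[eF /eqP sx /eqP ty]];
  by exists (e, ~~ i); rewrite /hsrc /htgt /= eF -sx -ty /hsrc /htgt /= ?negbK !eqxx.
Qed.

Lemma link_csym (G : mgraph) (F : {set edge G}) : connect_sym (link F).
Proof. exact/sym_connect_sym/link_sym. Qed.

(* The vertices of the contraction are canonical representatives of the
   components of the spanning subgraph with edge set [F]. *)
Definition contract_vert (G : mgraph) (F : {set edge G}) : finType :=
  {x : vert G | x \in roots (link F)}.

Definition contract_proj (G : mgraph) (F : {set edge G}) (x : vert G) :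
    contract_vert F :=
  exist _ (root (link F) x) (roots_root (@link_csym G F) x).

Definition contract (G : mgraph) (F : {set edge G}) : mgraph :=
  @MGraph (contract_vert F) {e : edge G | e \notin F}
    (fun e i => contract_proj F (endv (val e) i)).

(* Subdivision: each edge [e] is replaced by a path with [l e] edges (for
   [l e >= 1]); its [(l e).-1] inner vertices are the new vertices. *)

Section Subdivide.
Variables (G : mgraph) (l : edge G -> nat).

Definition subdiv_vert : finType := (vert G + {e : edge G & 'I_(l e).-1})%type.

(* the j-th vertex, 0 <= j <= l e, of the path replacing e *)
Definition path_vert (e : edge G) (j : nat) : subdiv_vert :=
  if j == 0 then inl (endv e false)
  else if (insub j.-1 : option 'I_(l e).-1) is Some i
       then inr (Tagged (fun e => 'I_(l e).-1) i)
       else inl (endv e true).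

Definition subdivide : mgraph :=
  @MGraph subdiv_vert {e : edge G & 'I_(l e)}
    (fun s i => path_vert (tag s) (tagged s + i)).

End Subdivide.

Definition weak_subdivision (D : mgraph) (l : edge D -> nat) : mgraph :=
  @subdivide (contract [set e | l e == 0]) (fun e => l (val e)).

(* [l] is a system of chain lengths of [G] relative to [D].  As the edges of
   weight 0 contain no cycle, contracting them simultaneously amounts to
   contracting them one at a time. *)
Definition chain_lengths (D G : mgraph) (l : edge D -> nat) : Prop :=
  (forall c : seq (halfedge D), is_cycle c -> 0 < \sum_(h <- c) l h.1) /\
  iso G (weak_subdivision l).

Definition weak_distillation (D G : mgraph) : Prop :=
  cubic D /\ exists l : edge D -> nat, chain_lengths G l.

Definition has_weak_distillation_in_Dk (k : nat) (G : mgraph) : Prop :=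
  exists2 D : mgraph, in_Dk k D & weak_distillation D G.

Definition balanced_lengths (D : mgraph) (l : edge D -> nat) : Prop :=
  forall e f : edge D, l e <= (l f).+1.

(* Expansion of a new edge [None] at [v]: the vertex v_1 is [Some v], the vertex
   v_2 is [None], and the incidences with [v] assigned to v_2 are those in [S]. *)
Definition expand (G : mgraph) (v : vert G) (S : {set halfedge G}) : mgraph :=
  @MGraph (option (vert G)) (option (edge G))
    (fun oe i => match oe with
       | Some e => if (endv e i == v) && ((e, i) \in S) then None
                   else Some (endv e i)
       | None => if i then None else Some v
       end).

Definition shift (G H : mgraph) : Prop :=
  exists (e : edge G) (v : vert G) (S : {set halfedge G}),
    let B : {set edge (expand v S)} := [set Some e; None] in
    let e1 : {set edge (expand v S)} := [set Some e] in
    sbond 2 B /\ iso H (contract e1).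

Inductive shifts : mgraph -> mgraph -> Prop :=
| shifts_iso G H : iso G H -> shifts G H
| shifts_step G G' H : shift G G' -> shifts G' H -> shifts G H.

Definition equivalent (G H : mgraph) : Prop := shifts G H \/ shifts H G.

(* Main.v *)
Require Import Defs.
From mathcomp Require Import all_boot.
From mathcomp Require Import zify.
From Stdlib Require Import Classical.

(** A weak subdivision [G] of [(H, l)] is handled through explicit maps, called a
    model of [G].  In a model, contracting an edge of [G] lowers one length by
    one, and undoing the contraction of an edge at a vertex of degree 2 raises
    one length by one.

    (a) The trace on [H] of a 2-cut of [G] is a 2-cut of [H], unless both edges
    lie on the same chain; so if [H] is 3-edge-connected then all 2-bonds of [G]
    are trivial.  Conversely, if all 2-bonds of [G] are trivial, contracting one
    edge at each vertex of degree 2 produces a 3-edge-connected graph.  In such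
    a graph every vertex of degree at least 4 can be split without creating a
    small cut, because the obstructions to splitting are 3-cuts which can be
    uncrossed.  Splitting as long as possible gives a cubic graph [D], in which
    the new edges receive length 0.

    (b) Take [H = G] with unit lengths.  Belonging to a common 2-cut is an
    equivalence relation on edges, and a shift moves one unit of length between
    two edges of the same class.  Once each class has all its length on one
    edge, all 2-bonds are trivial.

    (c) A shift is symmetric: it relates [K / e'] to [K / e] for a 2-bond
    [{e, e'}] of some [K].  Being 3-edge-connected is invariant under shifts,
    and so is being a subdivision with positive lengths of a given [D].  Hence
    there is a zero chain.  If the lengths were balanced they would be at most
    1, so the shifted graph, a contraction of [D], would be 3-edge-connected,
    and therefore [G] too. *)

Set Implicit Arguments.
Unset Strict Implicit.
Unset Printing Implicit Defensive.

(* Plain [lia] is intractable in the contexts below: it unfolds local definitions. *)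
Ltac nat_lia :=
  repeat match goal with x := _ |- _ => clearbody x end;
  repeat match goal with
  | H : forall _, _ |- _ => clear H
  | H : ?T |- _ => lazymatch type of T with Prop =>
      lazymatch T with
      | context [leq] => fail
      | context [@eq ?A _ _] => tryif unify A nat then fail else clear H
      | context [@eq_op Datatypes_nat__canonical__eqtype_Equality] => fail
      | _ => clear H
      end end
  end; lia.

Lemma inj_surj_bij (A B : finType) (f : A -> B) :
  injective f -> (forall y, exists x, f x = y) -> bijective f.
Proof.
move=> fI fS.
have fgP y : exists x, f x == y by case: (fS y) => x <-; exists x.
exists (fun y => xchoose (fgP y)) => [x|y]; last exact/eqP/(xchooseP (fgP y)).
by apply: fI; apply/eqP/(xchooseP (fgP (f x))).
Qed.

Lemma iso_refl G : iso G G.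
Proof.
by exists id, id; split=> [||e]; [exists id|exists id|exists false=> i; rewrite addFb].
Qed.

Lemma iso_sym G H : iso G H -> iso H G.
Proof.
move=> [f [g [[f' fK f'K] [g' gK g'K] fg]]].
exists f', g'; split; [by exists f|by exists g|] => e.
have [b eb] := fg (g' e); exists b => i; apply: (can_inj fK).
by rewrite f'K eb g'K addKb.
Qed.

(** * Cuts *)

Section Cuts.
Variable G : mgraph.
Implicit Types (X Y : {set vert G}) (e : edge G).

(** Edge-connectedness expressed through cuts. It holds vacuously when no two vertices can be
    separated, so nonemptiness is carried apart, as in [edge_connectedP]. *)
Definition cutge s := [forall X : {set vert G},
  (X != set0) && (X != setT) ==> (s <= #|crossing X|)].

Lemma cutgeP s : reflect (forall X x y, x \in X -> y \notin X -> s <= #|crossing X|) (cutge s).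
Proof.
apply: (iffP forallP) => [h X x y xX yX|h X].
  apply: (implyP (h X)); apply/andP; split; first by apply/set0Pn; exists x.
  by apply: contraNneq yX => ->; rewrite inE.
apply/implyP => /andP[/set0Pn[x xX]]; rewrite -subTset => /subsetPn[y _ yX].
exact: h xX yX.
Qed.

Lemma in_crossing X e i :
  (e \in crossing X) = ((endv e i \in X) != (endv e (~~ i) \in X)).
Proof. by rewrite inE; case: i; rewrite //= eq_sym. Qed.

Lemma crossing0 : crossing (set0 : {set vert G}) = set0.
Proof. by apply/setP=> e; rewrite !inE. Qed.

Lemma crossingC X : crossing (~: X) = crossing X.
Proof. by apply/setP=> e; rewrite !inE; do 2!case: (_ \in X). Qed.

Lemma crossing_nontrivial X e :
  e \in crossing X -> exists x y, x \in X /\ y \notin X.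
Proof.
rewrite inE; case A: (_ \in X); case B: (_ \in X) => // _.
  by exists (endv e false), (endv e true); rewrite A B.
by exists (endv e true), (endv e false); rewrite A B.
Qed.

Lemma cut_crossing X e : e \in crossing X -> cut (crossing X).
Proof.
move=> /crossing_nontrivial[x [y [xX yX]]]; apply/existsP; exists X; apply/and3P; split=> //.
  by apply/set0Pn; exists x.
by apply: contraNneq yX => ->; rewrite inE.
Qed.

Lemma cutP (C : {set edge G}) :
  reflect (exists X x y, [/\ x \in X, y \notin X & C = crossing X]) (cut C).
Proof.
apply: (iffP existsP) => [[X /and3P[/set0Pn[x xX] XT /eqP->]]|[X [x [y [xX yX ->]]]]].
  move: XT; rewrite -subTset => /subsetPn[y _ yX].
  by exists X, x, y.
exists X; apply/and3P; split=> //; first by apply/set0Pn; exists x.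
by apply: contraNneq yX => ->; rewrite inE.
Qed.

Definition symd (T : finType) (A B : {set T}) := [set x | (x \in A) (+) (x \in B)].

(** [crossing] is linear over GF(2). Adding a known 2-cut to another cut is how one edge is traded
    for another in all the exchange arguments below. *)
Lemma crossing_symd X Y : crossing (symd X Y) = symd (crossing X) (crossing Y).
Proof.
apply/setP=> e; rewrite !inE.
by do 4!case: (_ \in _).
Qed.

(** Submodularity, checked edge by edge on the four memberships of its ends. *)
Lemma crossing_submod X Y :
  #|crossing (X :&: Y)| + #|crossing (X :|: Y)| <= #|crossing X| + #|crossing Y|.
Proof.
have E (A : {set edge G}) : #|A| = \sum_e (e \in A) by rewrite -sum1_card big_mkcond; apply: eq_bigr => e _; case: (_ \in _).
rewrite !E -!big_split /=; apply: leq_sum => e _; rewrite !inE.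
by do 4!case: (_ \in _).
Qed.

Lemma cutge_cards s (C : {set edge G}) : cutge s -> cut C -> s <= #|C|.
Proof. by move=> /cutgeP h /cutP[X [x [y [xX yX ->]]]]; exact: h xX yX. Qed.

Lemma connected_crossing (F : {set edge G}) :
  0 < #|vert G| ->
  reflect (forall X x y, x \in X -> y \notin X -> exists2 e, e \in crossing X & e \notin F)
    (connected (delete F)).
Proof.
move=> G0; apply: (iffP andP) => [[_ /forallP h] X x y xX yX|h].
  have /forallP/(_ y) := h x => /connectP[s].
  elim: s x xX => [|z s IH] x xX /=; first by move=> _ yx; rewrite yx xX in yX.
  case/andP=> /existsP[[e i] /and3P[_ /eqP ex /eqP ez]].
  case zX: (z \in X); first exact: IH.
  move=> _ _; exists (val e); last exact: valP e.
  by rewrite (in_crossing _ _ i); rewrite /hsrc/= in ex; rewrite /htgt/= in ez; rewrite ex ez xX zX.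
split=> //; apply/forallP=> x; apply/forallP=> y; apply: contraT => nxy.
(* The component of [x] after the deletion is left by no surviving edge. *)
have [] := h [set z | connect (link [set: edge (delete F)]) x z] x y; rewrite ?inE ?connect0 //.
move=> e; rewrite inE => eX eF.
pose e' : edge (delete F) := exist _ e eF.
have C: connect (link [set: edge (delete F)]) (endv e false : vert (delete F)) (endv e true).
  by apply/connect1/existsP; exists (e', false); rewrite !inE /hsrc /htgt /= !eqxx.
move: eX; rewrite !inE => /negP[]; apply/eqP.
by apply: same_connect_r => //; apply: link_csym.
Qed.

Lemma edge_connectedP s :
  0 < s -> edge_connected s G <-> 0 < #|vert G| /\ cutge s.
Proof.
move=> s0; split=> [h|[G0 /cutgeP h] F Fs].
  have G0 : 0 < #|vert G| by have /andP[] : connected (delete (set0 : {set edge G})) by apply: h; rewrite cards0.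
  split=> //; apply/cutgeP => X x y xX yX; rewrite leqNgt; apply/negP=> /h.
  by move=> /(connected_crossing _ G0)/(_ X x y xX yX)[e ->].
apply/(connected_crossing _ G0) => X x y xX yX.
apply/subsetPn; apply: contraL Fs => sub; rewrite -leqNgt.
exact: leq_trans (h X x y xX yX) (subset_leq_card sub).
Qed.

End Cuts.

(** * Contraction *)

Section Contract.
Variables (G : mgraph) (F : {set edge G}).
Local Notation pi := (contract_proj F).

Lemma contract_proj_eq x y : (pi x == pi y) = connect (link F) x y.
Proof. by rewrite -val_eqE /= root_connect //; apply: link_csym. Qed.

Lemma contract_proj_val (u : vert (contract F)) : pi (val u) = u.
Proof. by apply: val_inj; apply/eqP; exact: valP u. Qed.

Lemma crossing_preim (X : {set vert (contract F)}) :
  crossing (pi @^-1: X) = val @: crossing X.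
Proof.
apply/setP=> e; apply/idP/imsetP => [eX|[u uX ->]]; last by move: uX; rewrite !inE.
have eF : e \notin F.
  apply/negP => eF; move: eX; rewrite !inE.
  suff -> : pi (endv e false) = pi (endv e true) by rewrite eqxx.
  by apply/eqP; rewrite contract_proj_eq; apply: connect1; apply/existsP; exists (e, false);
     rewrite eF /hsrc /htgt /= !eqxx.
by exists (exist _ e eF : edge (contract F)) => //; move: eX; rewrite !inE.
Qed.

Lemma card_crossing_preim (X : {set vert (contract F)}) :
  #|crossing (pi @^-1: X)| = #|crossing X|.
Proof. by rewrite crossing_preim card_imset //; apply: val_inj. Qed.

Lemma contract_cutge s : cutge G s -> cutge (contract F) s.
Proof.
move=> /cutgeP h; apply/cutgeP => X x y xX yX; rewrite -card_crossing_preim.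
by apply: (h _ (val x) (val y)); rewrite inE contract_proj_val.
Qed.

(** Membership in [X] is constant along edges of [F], hence on its components, so it can be read off
    at the canonical representatives. *)
Lemma uncrossed_preim (X : {set vert G}) :
  (forall e, e \in crossing X -> e \notin F) ->
  exists X' : {set vert (contract F)}, X = pi @^-1: X'.
Proof.
move=> h; exists [set u | val u \in X]; apply/setP=> x; rewrite !inE.
change ((x \in X) = (root (link F) x \in X)).
have: connect (link F) x (root (link F) x) by apply: connect_root.
move: (root _ _) => y /connectP[s]; elim: s x => [|z s IH] x /=; first by move=> _ ->.
case/andP=> /existsP[[e i] /and3P[eF /eqP ex /eqP ez]] P E.
rewrite -(IH z) //.
have : e \notin crossing X by apply/negP=> /h; rewrite eF.
by rewrite (in_crossing _ _ i) -ex -ez /hsrc /htgt /= negbK => /eqP.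
Qed.

(** Contraction destroys only the cuts that use a contracted edge; every other cut survives with its
    size. *)
Lemma cutge_noncontracted s (X : {set vert G}) x y :
  cutge (contract F) s -> x \in X -> y \notin X ->
  (forall e, e \in crossing X -> e \notin F) -> s <= #|crossing X|.
Proof.
move=> /cutgeP h xX yX /uncrossed_preim[X' XE]; rewrite {}XE in xX yX *.
by rewrite card_crossing_preim; apply: (h _ (pi x) (pi y)); move: xX yX; rewrite !inE.
Qed.

End Contract.

Lemma iso_cutge G H s : iso G H -> cutge G s -> cutge H s.
Proof.
move=> [f [g [[f' fK f'K] bg fg]]] /cutgeP h; apply/cutgeP=> X x y xX yX.
have <- : #|crossing (f @^-1: X)| = #|crossing X|.
  rewrite -(on_card_preimset (f := g)); last exact: onW_bij.
  apply: eq_card => e; rewrite !inE; have [b eb] := fg e; rewrite !eb.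
  by case: b {eb}; rewrite //= eq_sym.
by apply: (h _ (f' x) (f' y)); rewrite !inE f'K.
Qed.

(** * Contraction of a single edge *)

Section Contract1.
Variables (G : mgraph) (e : edge G).
Local Notation pi := (contract_proj [set e]).

Definition is_end (x : vert G) := (x == endv e false) || (x == endv e true).

Lemma contract1_proj_eq x y : (pi x == pi y) = (x == y) || (is_end x && is_end y).
Proof.
rewrite contract_proj_eq; apply/idP/idP => [/connectP[s]|].
  elim: s x => [|z s IH] x /=; first by move=> _ ->; rewrite eqxx.
  case/andP=> /existsP[[h i] /and3P[/set1P/= -> /eqP<- /eqP<-]] /IH {}IH /IH{IH}.
  rewrite /is_end /hsrc /htgt /=; case: i => /=; rewrite !eqxx /= ?orbT /=.
    by case/orP=> [/eqP<-|->]; rewrite ?eqxx ?orbT.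
  by case/orP=> [/eqP<-|->]; rewrite ?eqxx ?orbT.
case/orP=> [/eqP->|/andP[]]; first exact: connect0.
have C i : connect (link [set e]) (endv e i) (endv e (~~ i)).
  by apply: connect1; apply/existsP; exists (e, i); rewrite inE /hsrc /htgt /= !eqxx.
by case/orP=> /eqP-> /orP[] /eqP->; rewrite ?connect0 ?(C true) ?(C false).
Qed.

Lemma is_end_endv i : is_end (endv e i).
Proof. by rewrite /is_end; case: i; rewrite eqxx ?orbT. Qed.

Lemma is_endP x : reflect (exists i, x = endv e i) (is_end x).
Proof.
apply: (iffP orP) => [[] /eqP->|[[] ->]]; [by exists false|by exists true|by right|by left].
Qed.

Lemma contract1_proj_ends i j : pi (endv e i) = pi (endv e j).
Proof. by apply/eqP; rewrite contract1_proj_eq !is_end_endv orbT. Qed.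

Hypothesis nl : endv e false != endv e true.

Lemma card_vert_contract1 : #|vert G| = #|vert (contract [set e])|.+1.
Proof.
rewrite (cardD1 (endv e true)) inE add1n; congr _.+1.
have I : {in [predD1 (vert G) & endv e true] &, injective pi}.
  move=> x y; rewrite !inE !andbT => xt yt /eqP; rewrite contract1_proj_eq /is_end.
  rewrite (negbTE xt) (negbTE yt) !orbF => /orP[/eqP//|/andP[/eqP-> /eqP->]] //.
rewrite -(card_in_imset I) -cardsT; apply: eq_card => u; rewrite [RHS]inE.
apply/imsetP; have [E|E] := eqVneq (val u) (endv e true).
  exists (endv e false); first by rewrite !inE andbT nl.
  by rewrite (contract1_proj_ends false true) -E contract_proj_val.
by exists (val u); rewrite ?contract_proj_val // !inE E.
Qed.

Lemma card_edge_contract1 : #|edge G| = #|edge (contract [set e])|.+1.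
Proof.
rewrite card_sig (cardD1 e) inE add1n; congr _.+1.
by apply: eq_card => f; rewrite !inE andbT.
Qed.

(** The merged vertex inherits every half-edge at the two ends except the two halves of [e]; edges
    parallel to [e] become loops and still count twice. *)
Lemma deg_contract1 u :
  deg (pi u : vert (contract [set e])) =
  if is_end u then deg (endv e false) + deg (endv e true) - 2 else deg u.
Proof.
pose emb (h : halfedge (contract [set e])) : halfedge G := (val h.1, h.2).
have embI : injective emb by move=> [a i] [b j] [] /val_inj -> ->.
rewrite /deg -(card_imset _ embI).
have -> : emb @: [set h : halfedge (contract [set e]) | hsrc h == pi u] =
          [set h : halfedge G | (h.1 != e) && (pi (hsrc h) == pi u)].
  apply/setP=> -[f i]; apply/imsetP/idP => [[[f' i']]|].
    by rewrite !inE => /eqP E [-> ->]; rewrite -E eqxx andbT; have := valP f'; rewrite inE.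
  rewrite inE => /andP[/= fe /eqP E].
  have fF : f \notin [set e] by rewrite inE.
  by exists (exist _ f fF : edge (contract [set e]), i) => //; rewrite !inE -E.
case: ifPn => [eu|neu]; last first.
  apply: eq_card => -[f i]; rewrite !inE contract1_proj_eq (negbTE neu) andbF orbF /=.
  rewrite andbC; case: eqP => //= E; apply: contraNneq neu => fe.
  by rewrite -E /hsrc /= fe is_end_endv.
have -> : [set h : halfedge G | (h.1 != e) && (pi (hsrc h) == pi u)] =
  ([set h | hsrc h == endv e false] :|: [set h | hsrc h == endv e true])
   :\: [set (e, false); (e, true)].
  apply/setP=> -[f i]; rewrite !inE contract1_proj_eq eu andbT.
  have -> : ((f, i) == (e, false)) || ((f, i) == (e, true)) = (f == e).
    by rewrite !xpair_eqE; case: i; rewrite ?andbF ?andbT ?orbF.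
  rewrite /= /hsrc /=; congr (_ && _); apply/orP/idP => [[/eqP->|//]|]; last by right.
  exact: eu.
rewrite cardsD cardsU.
have -> : [set h | hsrc h == endv e false] :&: [set h | hsrc h == endv e true] = set0.
  by apply/setP=> h; rewrite !inE; apply/negP=> /andP[/eqP->]; apply/negP.
rewrite cards0 subn0; congr (_ - _).
have -> : forall A B : {set halfedge G}, B \subset A -> A :&: B = B by move=> A B /setIidPr.
  by rewrite cards2 xpair_eqE andbF.
apply/subsetP=> h; rewrite !inE /hsrc; case/orP=> /eqP->; by rewrite eqxx ?orbT.
Qed.

End Contract1.

(** * Models of weak subdivisions *)

(* [p c j] is the [j]-th vertex of the chain replacing [c], [f] gives the vertices
   of [G] coming from those of [H], and the edge [g] of [G] is the [r g]-th edge of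
   the chain of [q g], traversed backwards if [o g]. *)
Record model (H G : mgraph) (l : edge H -> nat) (q : edge G -> edge H)
    (r : edge G -> nat) (o : edge G -> bool)
    (f : vert H -> vert G) (p : edge H -> nat -> vert G) : Prop := Model {
  m_lt : forall g, r g < l (q g);
  m_inj : forall g g', q g = q g' -> r g = r g' -> g = g';
  m_surj : forall c j, j < l c -> exists g, q g = c /\ r g = j;
  m_end : forall g i, endv g i = p (q g) (r g + (o g (+) i));
  m_p0 : forall c, p c 0 = f (endv c false);
  m_pl : forall c, p c (l c) = f (endv c true);
  m_zero : forall x y, f x = f y -> connect (link [set c | l c == 0]) x y;
  m_inner : forall c j x, 0 < j < l c -> p c j <> f x;
  m_pinj : forall c j c' j', 0 < j < l c -> 0 < j' < l c' -> p c j = p c' j' ->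
    c = c' /\ j = j';
  m_cov : forall w, (exists x, w = f x) \/ exists c j, j <= l c /\ w = p c j }.

(** Only the chain [q g] of each edge is kept visible: shifts change lengths chain by chain, and
    positions within a chain can be chosen anew. *)
Definition modeled (H G : mgraph) (l : edge H -> nat) (q : edge G -> edge H) :=
  exists r o f p, model l q r o f p.

Definition no_zero_cycle (H : mgraph) (l : edge H -> nat) :=
  forall c : seq (halfedge H), is_cycle c -> 0 < \sum_(h <- c) l h.1.

Lemma modeled_ext (H G : mgraph) (l l' : edge H -> nat) (q q' : edge G -> edge H) :
  l =1 l' -> q =1 q' -> modeled l q -> modeled l' q'.
Proof.
move=> El Eq [r [o [f [p M]]]]; exists r, o, f, p.
have EZ : [set c | l' c == 0] = [set c | l c == 0] by apply/setP=> c; rewrite !inE El.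
split=> //.
- by move=> g; rewrite -El -Eq; apply: (m_lt M).
- by move=> g g'; rewrite -!Eq; apply: (m_inj M).
- by move=> c j; rewrite -El => /(m_surj M)[g [<- <-]]; exists g; rewrite -Eq.
- by move=> g i; rewrite -Eq; apply: (m_end M).
- exact: (m_p0 M).
- by move=> c; rewrite -El; apply: (m_pl M).
- by move=> x y; rewrite EZ; apply: (m_zero M).
- by move=> c j x; rewrite -El; apply: (m_inner M).
- by move=> c j c' j'; rewrite -!El; apply: (m_pinj M).
- move=> w; case: (m_cov M w) => [|[c [j [jl ->]]]]; first by left.
  by right; exists c, j; rewrite -El.
Qed.

(** Converse of [m_zero]: on a zero chain [p c 0] and [p c (l c)] are the same vertex. *)
Lemma model_zero_eq (H G : mgraph) (l : edge H -> nat) (q : edge G -> edge H) r o f p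
    (M : model l q r o f p) x y :
  connect (link [set c | l c == 0]) x y -> f x = f y.
Proof.
case/connectP=> s; elim: s x => [|z s IH] x /=; first by move=> _ ->.
case/andP=> /existsP[[c i] /and3P[]]; rewrite inE => /eqP lc /eqP<- /eqP<- P E.
rewrite -(IH _ P E) /hsrc /htgt /=.
have := m_pl M c; simpl in lc; rewrite lc (m_p0 M) => E2.
by case: (i) => /=.
Qed.

Lemma modeled_id (G : mgraph) : modeled (fun _ : edge G => 1) (@id (edge G)).
Proof.
exists (fun _ => 0), (fun _ => false), id, (fun c j => endv c (0 < j)).
split=> //.
- by move=> c j; case: j => // _; exists c.
- by move=> g i; rewrite add0n; case: i.
- by move=> x y ->.
- by move=> c [|[|j]].
- by move=> c [|[|j]].
- by left; exists w.
Qed.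

Section ModelIso.
Variables (H G G1 : mgraph) (l : edge H -> nat) (q : edge G -> edge H).

Lemma modeled_transport (a : vert G1 -> vert G) (b : edge G1 -> edge G) :
  bijective a -> bijective b ->
  (forall e, exists s, forall i, a (endv e i) = endv (b e) (s (+) i)) ->
  modeled l q -> modeled l (q \o b).
Proof.
move=> [a' aK a'K] [b' bK b'K] /fin_all_exists[s ab] [r [o [f [p M]]]].
exists (r \o b), (fun e => o (b e) (+) s e), (a' \o f), (fun c j => a' (p c j)).
split=> /=.
- by move=> g; apply: (m_lt M).
- by move=> g g' E1 E2; apply: (can_inj bK); apply: (m_inj M).
- by move=> c j /(m_surj M)[g [<- <-]]; exists (b' g); rewrite b'K.
- move=> g i; apply: (can_inj aK); rewrite a'K ab (m_end M).
  by rewrite addbA.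
- by move=> c; rewrite (m_p0 M).
- by move=> c; rewrite (m_pl M).
- by move=> x y /(can_inj a'K); apply: (m_zero M).
- by move=> c j x jl /(can_inj a'K); apply: (m_inner M).
- by move=> c j c' j' jl jl' /(can_inj a'K); apply: (m_pinj M).
- move=> w; case: (m_cov M (a w)) => [[x E]|[c [j [jl E]]]].
    by left; exists x; rewrite -E aK.
  by right; exists c, j; rewrite -E aK.
Qed.

End ModelIso.

Lemma iso_modeled (H G G1 : mgraph) (l : edge H -> nat) (q : edge G -> edge H) :
  iso G1 G -> modeled l q -> exists q1 : edge G1 -> edge H, modeled l q1.
Proof.
by move=> [a [b [ba bb ab]]] M; exists (q \o b); apply: modeled_transport M; eauto.
Qed.

Section ModelContract.
Variables (H K : mgraph) (l : edge H -> nat) (q : edge K -> edge H) (e : edge K).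
Let l' c := l c - (c == q e).

(** The chain through [e] loses one edge, and the positions behind it slide down by one. *)
Lemma modeled_contract : modeled l q ->
  modeled l' (fun u : edge (contract [set e]) => q (val u)).
Proof.
move=> [r [o [f [p M]]]].
pose pi : vert K -> vert (contract [set e]) := contract_proj [set e].
(* [sh] turns new positions into old ones; on [c0] it skips [j0], whose vertex is merged with the
   next one. *)
pose c0 := q e; pose j0 := r e; pose sh c j := if c == c0 then bump j0 j else j.
have j0l : j0 < l c0 := m_lt M e.
have shi c j : 0 < j < l' c -> 0 < sh c j < l c.
  by rewrite /l' /sh -/c0 /bump; case: eqP => [->|_]; nat_lia.
have shI c : injective (sh c) by move=> j j'; rewrite /sh /bump; case: eqP; nat_lia.
have shn c j : c = c0 -> sh c j <> j0 by move=> ->; rewrite /sh /bump eqxx; nat_lia.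
have pe0 : pi (p c0 j0) = pi (p c0 j0.+1).
  have := m_end M e false; have := m_end M e true; rewrite -/c0 -/j0.
  have := contract1_proj_ends e false true; rewrite -/pi => E.
  by case: (o e) => /=; rewrite ?addn0 ?addn1 => <- <-.
have piE x y : pi x = pi y -> x = y \/ (x = p c0 j0 /\ y = p c0 j0.+1) \/
    (y = p c0 j0 /\ x = p c0 j0.+1).
  move/eqP; rewrite contract1_proj_eq // => /orP[/eqP->|]; first by left.
  rewrite /is_end !(m_end M) -/c0 -/j0.
  by case: (o e) => /= /andP[] /orP[] /eqP-> /orP[] /eqP->; rewrite ?addn0 ?addn1; auto.
have inn c j : 0 < j < l' c -> p c (sh c j) <> p c0 j0.
  move=> jl E; have jl2 := shi _ _ jl.
  have [j00|j0p] := posnP j0.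
    by apply: (m_inner M jl2 (x := endv c0 false)); rewrite E j00 (m_p0 M).
  have [|Ec Ej] := m_pinj M jl2 _ E; first by rewrite j0p j0l.
  exact: (shn c j).
(* As [j0 < l c0], the position [j0] is either inner or the start of the chain. *)
have j0f x : f x = p c0 j0 -> j0 = 0.
  by case: (posnP j0) => // j0p E; case: (m_inner M (c := c0) (j := j0) (x := x)); rewrite ?j0p.
have lE c : l c = sh c (l' c).
  by rewrite /sh /l' -/c0; case: eqP => [->|_]; rewrite /bump; nat_lia.
exists (fun u => if q (val u) == c0 then unbump j0 (r (val u)) else r (val u)),
  (fun u => o (val u)), (fun x => pi (f x)), (fun c j => pi (p c (sh c j))).
split.
- move=> u; have := m_lt M (val u); rewrite /l' -/c0.
  have := valP u; rewrite inE => ue.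
  have : q (val u) = c0 -> r (val u) <> j0.
    by move=> E1 E2; case/eqP: ue; apply: (m_inj M).
  case: eqP => [->|_ _]; first move=> /(_ erefl); rewrite /unbump /=; nat_lia.
- move=> u v Eq; rewrite -Eq => Er; apply: val_inj; apply: (m_inj M) => //; move: Er.
  have := valP u; rewrite inE => ue; have := valP v; rewrite inE => ve.
  have : q (val u) = c0 -> r (val u) <> j0.
    by move=> E1 E2; case/eqP: ue; apply: (m_inj M).
  have : q (val u) = c0 -> r (val v) <> j0.
    by move=> E1 E2; case/eqP: ve; apply: (m_inj M) => //; rewrite -Eq.
  case: eqP => // Ec /(_ Ec) + /(_ Ec); rewrite /unbump /=; nat_lia.
- move=> c j jl.
  have jl2 : sh c j < l c by move: jl; rewrite /l' /sh -/c0 /bump; case: eqP => [->|_]; nat_lia.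
  have [g [gc gj]] := m_surj M jl2.
  have ge : g \notin [set e].
    by rewrite inE; apply/eqP => E; apply: (shn c j); rewrite -?gj -?gc E.
  exists (exist _ g ge); split=> //=; rewrite gc gj /sh.
  by case: eqP => // _; rewrite bumpK.
- move=> u i /=; rewrite (m_end M) -/pi /sh; have := valP u; rewrite inE => ue.
  have : q (val u) = c0 -> r (val u) <> j0.
    by move=> E1 E2; case/eqP: ue; apply: (m_inj M).
  case: eqP => // -> /(_ erefl); move: (r (val u)) (_ (+) _) => n x nj.
  (* The edge just before [e] ends at the skipped position [j0]; there the merging [pe0] is used. *)
  have [E|E] := boolP (n.+1 == j0 :> nat).
    case: x.
      have -> : bump j0 (unbump j0 n + true) = j0.+1 by rewrite /bump /unbump; nat_lia.
      by rewrite addn1 (eqP E).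
    by congr (pi (p _ _)); rewrite /bump /unbump; nat_lia.
  by congr (pi (p _ _)); rewrite /bump /unbump; case: x; nat_lia.
- move=> c; rewrite /sh; case: eqP => [->|_]; last by rewrite (m_p0 M).
  case: (posnP j0) => [j00|j0p].
    by have := pe0; rewrite j00 -(m_p0 M) => ->.
  by rewrite -(m_p0 M) /bump leqNgt j0p.
- by move=> c; rewrite -(m_pl M) lE.
- have ZZ x y : f x = f y -> connect (link [set c | l' c == 0]) x y.
    move=> /(m_zero M); apply: connect_sub => {}x {}y.
    case/existsP=> h /and3P[]; rewrite inE => /eqP hZ hx hy.
    by apply: connect1; apply/existsP; exists h; rewrite hx hy inE /l' hZ.
  (* Two images under [f] are newly merged only if [e] is its entire chain, which then becomes a
     zero chain. *)
  have Z0 x y : f x = p c0 j0 -> f y = p c0 j0.+1 -> connect (link [set c | l' c == 0]) x y.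
    move=> fx fy; have j00 := j0f _ fx.
    have l1 : l c0 = 1.
      apply/eqP; rewrite eqn_leq; apply/andP; split; last by nat_lia.
      by rewrite leqNgt; apply/negP=> lt; apply: (m_inner M (c := c0) (j := j0.+1) (x := y)); rewrite ?fy //; nat_lia.
    apply: connect_trans (_ : connect _ (endv c0 false) _).
      by apply: ZZ; rewrite fx j00 (m_p0 M).
    apply: connect_trans (_ : connect _ (endv c0 true) _); last first.
      by apply: ZZ; rewrite -(m_pl M) l1 fy j00.
    apply: connect1; apply/existsP; exists (c0, false).
    by rewrite inE /l' eqxx l1 /hsrc /htgt /= !eqxx.
  move=> x y /piE[|[[]|[]]]; [exact: ZZ|exact: Z0|].
  by move=> fy fx; rewrite link_csym; apply: Z0.
- move=> c j x jl /piE[|[[]|[]]].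
  + by apply: (m_inner M); apply: shi.
  + by move=> /(inn _ _ jl).
  + move=> fx pj; have j00 := j0f _ fx; move: pj; rewrite j00 => pj.
    have [l1|l1] := eqVneq (l c0) 1.
      by apply: (m_inner M (shi _ _ jl) (x := endv c0 true)); rewrite pj -(m_pl M) l1.
    have [|Ec Ej] := m_pinj M (shi _ _ jl) _ pj; first by nat_lia.
    by move: Ej jl; rewrite /sh Ec eqxx j00 /bump; nat_lia.
- move=> c j c' j' jl jl' /piE[|[[]|[]]].
  + by move=> E; have [Ec] := m_pinj M (shi _ _ jl) (shi _ _ jl') E; subst c' => /shI.
  + by move=> /(inn _ _ jl).
  + by move=> /(inn _ _ jl').
- move=> w; have <- : pi (val w) = w by apply: contract_proj_val.
  have B c j : j <= l c -> (c = c0 -> j <> j0) -> exists c' j', j' <= l' c' /\ pi (p c j) = pi (p c' (sh c' j')).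
    move=> jl jj; exists c, (if c == c0 then unbump j0 j else j).
    rewrite /sh /l' -/c0; case: eqP => [E|_]; last by split=> //; nat_lia.
    have := jj E; move=> jj0; split; last by rewrite unbumpK // inE; apply/eqP.
    by rewrite E in jl *; rewrite /unbump; nat_lia.
  case: (m_cov M (val w)) => [[x ->]|[c [j [jl ->]]]]; first by left; exists x.
  right; have [/andP[/eqP-> /eqP->]|N] := boolP ((c == c0) && (j == j0)).
    by rewrite pe0; apply: B => //; nat_lia.
  by apply: B => // E1 E2; rewrite E1 E2 !eqxx in N.
Qed.

Hypothesis nl : endv e false != endv e true.

(** On a cycle that becomes zero, [e] was the only unit of length. Following the zero edges around
    the cycle identifies the two ends of its chain, so [e] would be a loop. *)
Lemma no_zero_cycle_contract :
  modeled l q -> no_zero_cycle l -> no_zero_cycle l'.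
Proof.
move=> [r [o [f [p M]]]] nz s cs; rewrite lt0n; apply/negP => /eqP S0.
have Z h : h \in s -> l' h.1 = 0.
  by move=> hs; apply/eqP; rewrite -leqn0 -S0 (big_rem h) //= leq_addr.
have [h0 h0s lh0] : exists2 h, h \in s & 0 < l h.1.
  apply/hasP; apply: contraT => /hasPn N; have := nz _ cs; rewrite big1_seq // => h.
  by move=> /= /N; rewrite -leqNgt leqn0 => /eqP.
have E0 : h0.1 = q e.
  by apply/eqP; apply: contraTT lh0 => ne; rewrite -leqNgt -(Z _ h0s) /l' (negbTE ne) subn0.
have l1 : l (q e) = 1 by have := Z _ h0s; rewrite /l' E0 eqxx; rewrite E0 in lh0; nat_lia.
have [_ cy ue _] := and4P cs.
have [i s' rs] := rot_to h0s.
have cy' : cycle (@consec H) (h0 :: s') by rewrite -rs rot_cycle.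
have ue' : uniq [seq h.1 | h <- h0 :: s'] by rewrite -rs map_rot rot_uniq.
have Z' h : h \in s' -> f (hsrc h) = f (htgt h).
  move=> hs; have hs' : h \in s by rewrite -(mem_rot i) rs inE hs orbT.
  have : l h.1 = 0.
    have := Z _ hs'; rewrite /l'; case: eqP => [E|]; last by rewrite subn0.
    move: ue'; rewrite /= => /andP[/negP[]]; rewrite E0 -E.
    exact: (map_f (fun h => h.1)).
  move=> l0; have := m_pl M h.1; rewrite l0 (m_p0 M) /hsrc /htgt.
  by case: (h.2) => /=.
have C : f (htgt h0) = f (hsrc h0).
  move: cy' Z' {rs ue'}; rewrite /=.
  have : forall h, path (@consec H) h (rcons s' h0) ->
    {in s', forall h, f (hsrc h) = f (htgt h)} -> f (htgt h) = f (hsrc h0).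
    elim: (s') => [|h1 t IH] h /=; first by rewrite andbT => /eqP->.
    case/andP=> /eqP-> P Zt; rewrite (Zt h1) ?mem_head //.
    by apply: IH => // h2 h2t; apply: Zt; rewrite inE h2t orbT.
  by move=> A /A.
have C2 : f (endv (q e) false) = f (endv (q e) true).
  by move: C; rewrite /htgt /hsrc E0; case: (h0.2).
have := m_lt M e; rewrite l1 ltnS leqn0 => /eqP re.
move: nl; rewrite !(m_end M) re; move: C2; rewrite -(m_p0 M) -(m_pl M) l1.
by case: (o e) => /= ->; rewrite eqxx.
Qed.

End ModelContract.

(** * Undoing a contraction at a vertex of degree 2 *)

Section ModelSubdivide.
Variables (H K : mgraph) (l : edge H -> nat) (x : vert K)
  (e g : edge K) (i0 i1 : bool).

(** The sides [i0] and [i1] are recorded because they decide on which side of [g] the edge [e] is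
    inserted into the chain. *)
Definition series_vertex := [/\ e <> g, endv e i0 = x, endv g i1 = x &
  forall h i, endv h i = x -> (h, i) = (e, i0) \/ (h, i) = (g, i1)].

Hypothesis S : series_vertex.

Lemma series_nonloop : endv e false != endv e true.
Proof.
have [ne ex gx hx] := S; apply/eqP => E.
have /hx[[]|[/ne//]] : endv e (~~ i0) = x by rewrite -ex; case: i0.
by case: i0.
Qed.

Hypothesis gF : g \notin [set e].
Let g' : edge (contract [set e]) := exist _ g gF.

(** Inverse of [modeled_contract]: [e] is inserted next to [g], and [x] becomes the vertex at
    position [j0.+1] of their chain. *)
Lemma modeled_subdivide (q : edge (contract [set e]) -> edge H) :
  modeled l q ->
  exists q' : edge K -> edge H,
    [/\ modeled (fun c => l c + (c == q g')) q', q' e = q g' &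
        forall u, q' (val u) = q u].
Proof.
have [/eqP ne ex gx hx] := S; have nl := series_nonloop.
move=> [r [o [f [p M]]]].
pose pi : vert K -> vert (contract [set e]) := contract_proj [set e].
pose y := endv e (~~ i0).
have yx : y != x by rewrite -ex /y; case: i0 => //=; rewrite eq_sym.
(* A section of [pi] avoiding [x]: the merged vertex is represented by the other end [y] of [e]. *)
pose s (w : vert (contract [set e])) := if val w == x then y else val w.
have isx : is_end e x by rewrite -ex; apply: is_end_endv.
have isy : is_end e y by apply: is_end_endv.
have sx w : s w <> x by rewrite /s; case: ifP => [_|/eqP//]; apply/eqP.
have pis w : pi (s w) = w.
  rewrite /s; case: eqP => [E|_]; last exact: contract_proj_val.
  by rewrite -[RHS]contract_proj_val E; apply/eqP; rewrite contract1_proj_eq isx isy orbT.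
have sI : injective s by apply: can_inj pis.
have spi w : w <> x -> s (pi w) = w.
  move=> /eqP wx; have /eqP := pis (pi w); rewrite contract1_proj_eq => /orP[/eqP//|/andP[]].
  have N z : is_end e z -> z <> x -> z = y.
    by rewrite -ex /y => /is_endP[i ->]; case: i i0 => [] [].
  by move=> /N -> // /N -> //; apply/eqP.
have spx : s (pi x) = y.
  have /eqP := pis (pi x); rewrite contract1_proj_eq => /orP[/eqP/sx//|/andP[]].
  by move=> /is_endP[i E] _; move: (sx (pi x)); rewrite E -ex /y; case: i i0 {E} => [] [].
(* In the direction of the chain, [e] precedes [g] exactly when [t] is false. *)
pose c0 := q g'; pose j0 := r g'; pose t := o g' (+) i1.
have j0l : j0 < l c0 := m_lt M g'.
pose u h : edge (contract [set e]) := insubd g' h.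
have uK h : h != e -> val (u h) = h by move=> he; rewrite val_insubd inE he.
have ue : u e = g' by rewrite /u /insubd insubF ?inE ?eqxx.
have ug : u g = g' by apply: val_inj; rewrite uK // eq_sym.
have uval w : u (val w) = w by apply: val_inj; rewrite uK //; have := valP w; rewrite inE.
(* [e] and [g] occupy the positions [j0] and [j0.+1] in the order given by [t]; the edges beyond
   them move up by one. *)
pose r' h := if h == e then j0 + t else if h == g then j0 + ~~ t
  else if q (u h) == c0 then bump j0.+1 (r (u h)) else r (u h).
pose o' h := if h == e then ~~ t (+) i0 else o (u h).
pose p' c j := if c == c0 then if j == j0.+1 then x else s (p c (unbump j0.+1 j))
  else s (p c j).
pose l' c := l c + (c == c0).
have r'e : r' e = j0 + t by rewrite /r' eqxx.
have r'g : r' g = j0 + ~~ t by rewrite /r' eq_sym (negbTE ne) eqxx.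
have r'n h : h != e -> h != g -> r' h = if q (u h) == c0 then bump j0.+1 (r (u h)) else r (u h).
  by rewrite /r' => /negbTE-> /negbTE->.
have p'n c j : p' c j <> x -> p' c j = s (p c (if c == c0 then unbump j0.+1 j else j)).
  by rewrite /p'; case: eqP => // _; case: eqP.
have rj h : h != e -> h != g -> q (u h) = c0 -> r (u h) <> j0.
  move=> he hg E1 E2; have := m_inj M E1 E2 => /(congr1 val); rewrite uK //= => E.
  by rewrite E eqxx in hg.
have inn c j : 0 < j < l' c -> p' c j <> x ->
    0 < (if c == c0 then unbump j0.+1 j else j) < l c.
  rewrite /p' /l'; case: eqP => [->|_]; last by rewrite addn0.
  by case: eqP => // ej; rewrite /unbump; nat_lia.
exists (fun h => q (u h)); split; [|by rewrite ue|by move=> w; rewrite uval].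
exists r', o', (fun z => s (f z)), p'; split.
- move=> h; rewrite -/c0; have [->|he] := eqVneq h e.
    by rewrite r'e ue -/c0 eqxx; case: (t); nat_lia.
  have [->|hg] := eqVneq h g; first by rewrite r'g ug -/c0 eqxx; case: (t); nat_lia.
  by rewrite r'n //; have := m_lt M (u h); case: eqP => [->|_]; rewrite /bump; nat_lia.
- have R h : h != e -> h != g -> q (u h) = c0 -> r' h <> j0 /\ r' h <> j0.+1.
    move=> he hg E; have := rj _ he hg E; rewrite r'n // E eqxx /bump; nat_lia.
  have EG h : h != e -> h != g -> c0 = q (u h) -> r' h <> r' e /\ r' h <> r' g.
    by move=> he hg /esym E; have := R _ he hg E; rewrite r'e r'g; case: (t) => /=; nat_lia.
  have eg : r' e <> r' g by rewrite r'e r'g; case: (t) => /=; nat_lia.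
  move=> h1 h2; have [->|h1e] := eqVneq h1 e.
    have [->//|h2e] := eqVneq h2 e.
    have [-> _ /eg//|h2g] := eqVneq h2 g.
    by rewrite ue => /(EG _ h2e h2g)[A B] /esym.
  have [->|h1g] := eqVneq h1 g.
    have [-> _ /esym/eg//|h2e] := eqVneq h2 e.
    have [->//|h2g] := eqVneq h2 g.
    by rewrite ug => /(EG _ h2e h2g)[A B] /esym.
  have [->|h2e] := eqVneq h2 e.
    by rewrite ue => /esym/(EG _ h1e h1g)[A B].
  have [->|h2g] := eqVneq h2 g.
    by rewrite ug => /esym/(EG _ h1e h1g)[A B].
  move=> Eq; rewrite !r'n // -Eq => Er; rewrite -(uK h1) // -(uK h2) //; congr (val _).
  by apply: (m_inj M) => //; move: Er; case: eqP => // _; apply: (can_inj (bumpK _)).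
- have E0 : forall d : bool, exists h, q (u h) = c0 /\ r' h = j0 + d.
    move=> d; have [->|/eqP] := eqVneq d t; first by exists e; rewrite ue r'e.
    by move=> dt; exists g; rewrite ug r'g; split=> //; move: dt; case: d (t) => [] [].
  move=> c j; rewrite -/c0; have [->|cc] := eqVneq c c0; last first.
    rewrite addn0 => /(m_surj M)[h [hc hj]]; exists (val h); rewrite uval; split=> //.
    rewrite r'n ?uval ?hc ?(negbTE cc) //; first by have := valP h; rewrite inE.
    apply: contraNneq cc => E; rewrite -hc; apply/eqP; congr (q _).
    by apply: val_inj.
  move=> jl; have [|jn] := boolP ((j == j0) || (j == j0.+1)).
    by case/orP=> /eqP->; [case: (E0 false)|case: (E0 true)] => h [h1 h2];
       exists h; rewrite h2 ?addn0 ?addn1.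
  have /(m_surj M)[h [hc hj]] : unbump j0.+1 j < l c0 by rewrite /unbump; nat_lia.
  exists (val h); rewrite uval; split=> //.
  rewrite r'n ?uval ?hc ?eqxx ?hj ?unbumpK ?inE //; first by nat_lia.
    by have := valP h; rewrite inE.
  apply/eqP => E; have : h = g' by apply: val_inj.
  by move=> hg; move: hj; rewrite hg -/j0 /unbump; nat_lia.
- move=> h i; have [->|he] := eqVneq h e.
    rewrite r'e /o' eqxx ue -/c0 /p' eqxx.
    have [->|/eqP ii] := eqVneq i i0.
      by rewrite addbK ex; case: (t) => /=; rewrite ?addn0 ?addn1 eqxx.
    have -> : i = ~~ i0 by move: ii; case: i i0 => [] [].
    have -> : ~~ t (+) i0 (+) ~~ i0 = t by case: (t) i0 => [] [].
    have px : pi x = p c0 (j0 + t).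
      rewrite -gx /c0 /j0 /t; have := m_end M g' i1; rewrite -/pi => <- //.
    case: ifP => [|_]; first by case: (t); nat_lia.
    by rewrite -/y -spx px; congr (s (p _ _)); rewrite /unbump; case: (t) => /=; nat_lia.
  have oe : o' h = o (u h) by rewrite /o' (negbTE he).
  have [hgE|hg] := eqVneq h g.
    rewrite oe hgE r'g ug -/c0 /p' eqxx.
    have [->|/eqP ii] := eqVneq i i1.
      by rewrite -/t gx; case: (t) => /=; rewrite ?addn0 ?addn1 eqxx.
    have iE : i = ~~ i1 by move: ii; case: i i1 => [] [].
    have -> : o g' (+) i = ~~ t by rewrite iE /t addbN.
    case: ifP => [|_]; first by case: (t); nat_lia.
    have gn : endv g i <> x.
      by move=> /hx[[E]|[E]]; [rewrite E eqxx in ne|apply: ii].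
    rewrite -(spi _ gn) -[pi _]/(endv g' i) (m_end M) -/c0 -/j0.
    congr (s (p _ _)); rewrite iE addbN -/t /unbump; case: (t) => /=; nat_lia.
  have hn : endv h i <> x.
    by move=> /hx[[E]|[E]]; [rewrite E eqxx in he|rewrite E eqxx in hg].
  rewrite -(spi _ hn); have := m_end M (u h) i; rewrite -[endv (u h) i]/(pi (endv (val (u h)) i)) uK // oe => ->.
  rewrite r'n // /p'; case: eqP => // E; have := rj _ he hg E; move: (r (u h)) (_ (+) _) => n d nj.
  case: ifP => [|_]; first by rewrite /bump; nat_lia.
  by rewrite E; congr (s (p _ _)); rewrite /bump /unbump; case: d; nat_lia.
- by move=> c; rewrite /p' /= !(m_p0 M); case: eqP.
- move=> c; rewrite -/c0 /p'; case: eqP => [->|_]; last by rewrite addn0 (m_pl M).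
  case: ifP => [|_]; first by nat_lia.
  by rewrite -(m_pl M); congr (s (p _ _)); rewrite /unbump; nat_lia.
- move=> a b /sI /(m_zero M); apply: connect_sub => {}a {}b.
  case/existsP=> h /and3P[]; rewrite inE => /eqP hZ ha hb.
  apply: connect1; apply/existsP; exists h; rewrite ha hb inE hZ /=.
  by rewrite -/c0; case: (h.1 =P c0) => // E; move: j0l; rewrite -E hZ.
- move=> c j z jl E.
  have px : p' c j <> x by rewrite E; apply: sx.
  by move: E; rewrite p'n // => /sI; apply: (m_inner M); apply: inn.
- have L1 c j : p' c j = x -> c = c0 /\ j = j0.+1.
    by rewrite /p'; case: eqP => [->|_ /sx//]; case: eqP => [->//|_ /sx].
  move=> c j c' j' jl jl'; have [E|/eqP px] := eqVneq (p' c j) x.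
    by rewrite E => /esym/L1[-> ->]; have [-> ->] := L1 _ _ E.
  move=> E; have px' : p' c' j' <> x by rewrite -E.
  move: E; rewrite (p'n _ _ px) (p'n _ _ px') => /sI E.
  have [Ec] := m_pinj M (inn _ _ jl px) (inn _ _ jl' px') E; subst c'.
  move=> Ej; split=> //; move: px px' Ej; rewrite /p'; case: eqP => // _.
  by case: eqP => // n1 _; case: eqP => // n2 _; rewrite /unbump; nat_lia.
- move=> w; have [->|/eqP wx] := eqVneq w x.
    by right; exists c0, j0.+1; rewrite -/c0 /p' !eqxx; split=> //; nat_lia.
  rewrite -(spi _ wx); case: (m_cov M (pi w)) => [[z ->]|[c [j [jl ->]]]]; first by left; exists z.
  right; exists c, (if c == c0 then bump j0.+1 j else j); rewrite -/c0 /p'.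
  case: eqP => [E|_]; last by split=> //; nat_lia.
  split; first by rewrite /bump; nat_lia.
  by rewrite bumpK eq_sym (negbTE (neq_bump _ _)).
Qed.

End ModelSubdivide.

Lemma iso_from (G W : mgraph) (f : vert W -> vert G) (g : edge G -> edge W) :
  bijective f -> bijective g ->
  (forall e, exists b, forall i, endv e i = f (endv (g e) (b (+) i))) -> iso G W.
Proof.
move=> [f' fK f'K] bg E; exists f', g; split=> //; first by exists f.
by move=> e; have [b Eb] := E e; exists b => i; rewrite Eb fK.
Qed.

(** * Models agree with weak subdivisions up to isomorphism *)

Section WeakSubdivision.
Variables (D : mgraph) (l : edge D -> nat).
Let Z := [set e | l e == 0].
Let W := weak_subdivision l.
Local Notation lz := (fun e : edge (contract Z) => l (val e)).

Lemma path_vert_in (c : edge (contract Z)) j (jl : j.-1 < (l (val c)).-1) : 0 < j ->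
  path_vert lz c j = inr (Tagged (fun e : edge (contract Z) => 'I_(l (val e)).-1) (Ordinal jl)).
Proof.
rewrite /path_vert; case: j jl => // j jl _ /=; rewrite insubT /=.
by congr (inr (Tagged _ _)); apply: val_inj.
Qed.

Lemma path_vert_last (c : edge (contract Z)) :
  path_vert lz c (l (val c)) = inl (endv c true).
Proof.
have := valP c; rewrite inE /path_vert => /negbTE->.
by rewrite insubF // ltnn.
Qed.

Lemma modeled_weak_subdivision : exists q : edge W -> edge D, modeled l q.
Proof.
(* The default covers the edges of weight 0: all positions of a zero chain are its single merged
   vertex. *)
pose P c j : vert W :=
  if insub c is Some c' then path_vert lz c' j else inl (contract_proj Z (endv c false)).
have PE (c : edge (contract Z)) j : P (val c) j = path_vert lz c j by rewrite /P valK.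
have Pin c j : 0 < j < l c -> exists t : {e : edge (contract Z) & 'I_(l (val e)).-1},
    [/\ P c j = inr t, c = val (tag t) & j.-1 = tagged t :> nat].
  move=> jl; have cZ : c \notin Z by rewrite inE; nat_lia.
  have -> : c = val (exist _ c cZ : edge (contract Z)) by [].
  rewrite PE; have jl2 : j.-1 < (l (val (exist _ c cZ : edge (contract Z)))).-1 by rewrite /=; nat_lia.
  by rewrite (path_vert_in jl2) /=; [eexists; split; first reflexivity|nat_lia].
pose R : edge W -> nat :=
  fun s : {e : edge (contract Z) & 'I_(l (val e))} => nat_of_ord (tagged s).
exists (fun s => val (tag s)), R, (fun _ => false),
  (fun x => inl (contract_proj Z x)), P; split.
- by move=> s; apply: ltn_ord.
- move=> [c j] [c' j'] /= /val_inj E; subst c' => E2.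
  by congr (existT _ _ _); apply: val_inj.
- move=> c j jl; have cZ : c \notin Z by rewrite inE; nat_lia.
  by exists (existT (fun e : edge (contract Z) => 'I_(l (val e))) (exist _ c cZ) (Ordinal jl)).
- by move=> s i; rewrite PE addFb.
- by move=> c; rewrite /P; case: insubP => [c' _ <-|].
- move=> c; rewrite /P; case: insubP => [c' cZ <-|]; first exact: path_vert_last.
  rewrite negbK => cZ; congr inl; apply/eqP; rewrite contract_proj_eq; apply: connect1.
  by apply/existsP; exists (c, false); rewrite cZ /hsrc /htgt /= !eqxx.
- by move=> x y [] /eqP; rewrite (root_connect (@link_csym D Z)).
- by move=> c j x /Pin[t [->]].
- move=> c j c' j' jl jl'; have [t [-> -> E1]] := Pin _ _ jl; have [t' [-> -> E2]] := Pin _ _ jl'.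
  case=> E; rewrite E in E1 *; split=> //; nat_lia.
- move=> [w|[c i]]; first by left; exists (val w); rewrite contract_proj_val.
  right; exists (val c), i.+1; have := ltn_ord i => il; split; first by nat_lia.
  by rewrite PE (path_vert_in (j := i.+1) il) //; congr (inr (existT _ _ _)); apply: val_inj.
Qed.

Lemma modeled_iso_weak_subdivision (G : mgraph) (q : edge G -> edge D) : modeled l q -> iso G W.
Proof.
move=> [r [o [f [p M]]]].
pose F (w : vert W) : vert G :=
  match w with inl u => f (val u) | inr t => p (val (tag t)) (tagged t).+1 end.
have qZ g : q g \notin Z by rewrite inE -lt0n; apply: leq_ltn_trans (m_lt M g).
pose B (g : edge G) : edge W := existT (fun e : edge (contract Z) => 'I_(l (val e)))
  (exist _ (q g) (qZ g)) (Ordinal (m_lt M g)).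
have Fr x : F (inl (contract_proj Z x)) = f x.
  by apply/esym; apply: (model_zero_eq M); apply: connect_root.
have FP (c : edge (contract Z)) j : j <= l (val c) -> F (path_vert lz c j) = p (val c) j.
  move=> jl; have [->|j0] := posnP j; first by rewrite (m_p0 M) Fr.
  move: jl; rewrite leq_eqVlt => /orP[/eqP->|jl]; first by rewrite path_vert_last (m_pl M) Fr.
  have jl2 : j.-1 < (l (val c)).-1 by nat_lia.
  by rewrite (path_vert_in jl2) //= prednK.
have inn (t : {e : edge (contract Z) & 'I_(l (val e)).-1}) :
    0 < (tagged t).+1 < l (val (tag t)) by have := ltn_ord (tagged t); nat_lia.
apply: (@iso_from _ _ F B).
- apply: inj_surj_bij.
    move=> [u|t] [v|s] /=.
    + move=> /(m_zero M) C; congr inl; rewrite -[u]contract_proj_val -[v]contract_proj_val.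
      by apply/eqP; rewrite contract_proj_eq.
    + by move=> /esym/(m_inner M (inn _)).
    + by move=> /(m_inner M (inn _)).
    + move=> /(m_pinj M (inn _) (inn _)); case: t s => [c i] [c' i'] /= [] /val_inj E; subst c'.
      by move=> [] /val_inj->.
  move=> y; case: (m_cov M y) => [[x ->]|[c [j [jl ->]]]].
    by exists (inl (contract_proj Z x)).
  have [cZ|cZ] := boolP (c \in Z).
    exists (inl (contract_proj Z (endv c false))); rewrite Fr -(m_p0 M).
    by move: cZ jl; rewrite inE => /eqP->; rewrite leqn0 => /eqP->.
  by exists (path_vert lz (exist _ c cZ) j); rewrite FP.
- apply: inj_surj_bij.
    move=> g g' E; apply: (m_inj M).
      by have := congr1 (fun s : edge W => val (tag s)) E.
    by have := congr1 (fun s : edge W => nat_of_ord (tagged s)) E.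
  move=> [[c cP] i]; have [g [gc gi]] := m_surj M (ltn_ord i); simpl in gc; subst c.
  have E : cP = qZ g by apply: bool_irrelevance.
  by subst cP; exists g; rewrite /B; congr (existT _ _ _); apply: val_inj.
- move=> g; exists (o g) => i; rewrite /= FP; first exact: (m_end M).
  by have := m_lt M g; case: (_ (+) _) => /=; nat_lia.
Qed.

End WeakSubdivision.

(** * Cuts and chains of a model *)

Section ModelCuts.
Variables (H G : mgraph) (l : edge H -> nat) (q : edge G -> edge H)
  (r : edge G -> nat) (o : edge G -> bool) (f : vert H -> vert G) (p : edge H -> nat -> vert G).
Hypothesis M : model l q r o f p.

Lemma crossing_model (X : {set vert G}) g :
  (g \in crossing X) = ((p (q g) (r g) \in X) (+) (p (q g) (r g).+1 \in X)).
Proof.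
rewrite inE !(m_end M); case: (o g) => /=; rewrite addn0 addn1;
  by do 2!case: (_ \in X).
Qed.

(** Along the chain of [c], membership in [X] flips exactly at the crossing edges, so the two ends
    are separated when the number of flips is odd. *)
Lemma crossing_parity (X : {set vert G}) c :
  (c \in crossing (f @^-1: X)) = odd #|[set g in crossing X | q g == c]|.
Proof.
have P m : m <= l c -> odd #|[set g in crossing X | (q g == c) && (r g < m)]|
    = (p c 0 \in X) (+) (p c m \in X).
  elim: m => [|m IH] ml.
    by rewrite addbb (_ : [set _ in _ | _] = set0) ?cards0 //; apply/setP=> g; rewrite !inE ltn0 !andbF.
  have [g [gc gm]] := m_surj M ml.
  have -> : [set g in crossing X | (q g == c) && (r g < m.+1)] =
     [set g in crossing X | (q g == c) && (r g < m)] :|: [set h in crossing X | h == g].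
    apply/setP=> h; rewrite !in_set; case: (_ != _) => //=.
    rewrite ltnS leq_eqVlt andb_orr orbC; congr (_ || _).
    apply/andP/eqP => [[/eqP hc /eqP hm]|->]; last by rewrite gc gm !eqxx.
    by apply: (m_inj M); rewrite ?hc ?hm ?gc ?gm.
  rewrite cardsU (_ : _ :&: _ = set0) ?cards0 ?subn0; last first.
    apply/setP=> h; rewrite [RHS]in_set0 in_setI !in_set; apply/negP=> /andP[/and3P[_ _ hm] /andP[_ /eqP E]].
    by rewrite E gm ltnn in hm.
  rewrite oddD (IH (ltnW ml)) -addbA; congr (_ (+) _).
  case gX : (g \in crossing X).
    rewrite (_ : [set _ in _ | _] = [set g]) ?cards1.
      by move: gX; rewrite crossing_model gc gm; do 2!case: (_ \in X).
    by apply/setP=> h; rewrite in_set in_set1; case: (h =P g) => [->|_]; rewrite ?gX ?andbF.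
  rewrite (_ : [set _ in _ | _] = set0) ?cards0.
    by move: gX; rewrite crossing_model gc gm; do 2!case: (_ \in X).
  by apply/setP=> h; rewrite in_set in_set0; apply/negP=> /andP[+ /eqP E]; rewrite E gX.
have := P _ (leqnn _); rewrite (m_p0 M) (m_pl M) => E.
rewrite !inE; transitivity (odd #|[set g in crossing X | (q g == c) && (r g < l c)]|).
  by rewrite E; do 2!case: (_ \in X).
congr (odd _); apply: eq_card => g; rewrite !in_set; congr (_ && _).
by case: eqP => //= <-; rewrite (m_lt M).
Qed.

(** By parity, the chains of [e] and [e'] are each crossed once and all others not at all. *)
Lemma cut_model e e' : q e <> q e' -> cut [set e; e'] -> cut [set q e; q e'].
Proof.
move=> ne /cutP[X [_ [_ [_ _ EX]]]].
have E : crossing (f @^-1: X) = [set q e; q e'].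
  apply/setP=> c; rewrite crossing_parity -EX !inE.
  have [->|ce] := eqVneq c (q e).
    rewrite (_ : [set _ in _ | _] = [set e]) ?cards1 //.
    apply/setP=> g; rewrite !inE; apply/andP/eqP => [[/orP[]/eqP->//]|->]; last by rewrite !eqxx.
    by move/eqP/esym.
  have [->|ce'] := eqVneq c (q e').
    rewrite (_ : [set _ in _ | _] = [set e']) ?cards1 ?orbT //.
    apply/setP=> g; rewrite !inE; apply/andP/eqP => [[/orP[]/eqP->//]|->]; last by rewrite !eqxx orbT.
    by move/eqP.
  rewrite (_ : [set _ in _ | _] = set0) ?cards0 //.
  apply/setP=> g; rewrite !inE; apply/negP=> /andP[/orP[]/eqP-> /eqP E].
    by rewrite E eqxx in ce.
  by rewrite E eqxx in ce'.
by rewrite -E; apply: (@cut_crossing _ _ (q e)); rewrite E !inE eqxx.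
Qed.

(** With lengths at most one there are no inner vertices and [q] is injective, so [G] is a
    contraction of [H] and its cuts are cuts of [H] of the same size. *)
Lemma cutge_model s : (forall c, l c <= 1) -> cutge H s -> cutge G s.
Proof.
move=> l1 /cutgeP h; apply/cutgeP => X x y xX yX.
have r0 g : r g = 0 by have := m_lt M g; have := l1 (q g); lia.
have qI : injective q by move=> g g' E; apply: (m_inj M); rewrite ?r0.
have cr : crossing (f @^-1: X) = q @: crossing X.
  apply/setP=> c; rewrite crossing_parity; apply/idP/imsetP => [|[g gX ->]].
    move=> /odd_gt0/card_gt0P[g].
    by rewrite in_set => /andP[gX /eqP<-]; exists g.
  rewrite (_ : [set _ in _ | _] = [set g]) ?cards1 //.
  by apply/setP=> g'; rewrite in_set in_set1; apply/andP/eqP => [[_ /eqP/qI]//|->]; rewrite eqxx.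
have fs w : exists z, w = f z.
  case: (m_cov M w) => // -[c [j [jl ->]]]; have := l1 c.
  case: j jl => [|j] jl lc; first by exists (endv c false); rewrite (m_p0 M).
  by exists (endv c true); rewrite -(m_pl M); congr (p c _); lia.
have [x' Ex] := fs x; have [y' Ey] := fs y.
by rewrite -(card_imset _ qI) -cr; apply: (h _ x' y'); rewrite !inE -?Ex -?Ey.
Qed.

(** Converse of [cut_model]: the two crossed chains are positive, and each can be broken at the
    prescribed edge. *)
Lemma cut_lift e e' : q e <> q e' -> cut [set q e; q e'] -> cut [set e; e'].
Proof.
move=> ne /cutP[Y [_ [_ [_ _ EY]]]].
have fY x y : f x = f y -> (x \in Y) = (y \in Y).
  move=> /(m_zero M) xy.
  have [|Y' E] := @uncrossed_preim _ [set c | l c == 0] Y.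
    by move=> c; rewrite -EY !inE => /orP[]/eqP->; rewrite -lt0n; apply: leq_ltn_trans (m_lt M _).
  rewrite E !inE; suff -> : contract_proj [set c | l c == 0] x = contract_proj _ y by [].
  by apply/eqP; rewrite contract_proj_eq.
(* The side of the [j]-th vertex: that of the start of the chain, switched on passing [e] or
   [e']. *)
pose chi c j := (endv c false \in Y) (+) ((c == q e) && (r e < j)) (+) ((c == q e') && (r e' < j)).
pose X := [set w | [exists y, (f y == w) && (y \in Y)] ||
   [exists c, [exists j : 'I_(l c), [&& 0 < j, p c j == w & chi c j]]]].
have fX y : (f y \in X) = (y \in Y).
  rewrite inE; apply/orP/idP => [[/existsP[z /andP[/eqP/fY->//]]|]|yY]; last first.
    by left; apply/existsP; exists y; rewrite eqxx.
  case/existsP=> c /existsP[j /and3P[j0 /eqP E _]].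
  by case: (m_inner M (c := c) (j := j) (x := y)); rewrite // j0 ltn_ord.
have pX c j : j <= l c -> (p c j \in X) = chi c j.
  have [->|j0] := posnP j.
    by rewrite (m_p0 M) fX /chi !ltn0 !andbF !addbF.
  rewrite leq_eqVlt => /orP[/eqP->|jl].
    rewrite (m_pl M) fX /chi.
    have -> : (c == q e) && (r e < l c) = (c == q e) by case: eqP => // ->; rewrite (m_lt M).
    have -> : (c == q e') && (r e' < l c) = (c == q e') by case: eqP => // ->; rewrite (m_lt M).
    have := in_crossing Y c true; rewrite -EY !inE /=.
    have : ~~ ((c == q e) && (c == q e')) by apply/negP=> /andP[/eqP-> /eqP].
    by do 2!case: (_ == _); do 2!case: (_ \in Y).
  rewrite inE; apply/orP/idP => [[/existsP[z /andP[/eqP E _]]|]|C].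
  - by case: (m_inner M (c := c) (j := j) (x := z)); rewrite ?j0.
  - case/existsP=> c' /existsP[j' /and3P[j0' /eqP E]].
    move: (nat_of_ord j') (ltn_ord j') j0' E => n nl n0 E.
    by have [||-> ->//] := m_pinj M _ _ E; rewrite ?n0 ?nl // j0.
  - by right; apply/existsP; exists c; apply/existsP; exists (Ordinal jl); rewrite j0 eqxx.
have EX : crossing X = [set e; e'].
  apply/setP=> g; rewrite crossing_model !pX ?(m_lt M) 1?ltnW ?(m_lt M) // !inE /chi.
  have D h : ((q g == q h) && (r h < (r g).+1)) = ((q g == q h) && (r h < r g)) (+) (g == h).
    have [->|gh] := eqVneq g h; first by rewrite eqxx ltnn ltnSn.
    rewrite addbF; case: eqP => //= E; rewrite ltnS leq_eqVlt.
    by case: eqP => // E2; case/eqP: gh; apply: (m_inj M).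
  rewrite !D; have : ~~ ((g == e) && (g == e')).
    by apply/negP=> /andP[/eqP E1 /eqP E2]; apply: ne; rewrite -E1 -E2.
  move: (endv _ _ \in Y) (_ && (r e < r g)) (_ && (r e' < r g)) (g == e) (g == e').
  by do 5!case.
by rewrite -EX; apply: (@cut_crossing _ _ e); rewrite EX !inE eqxx.
Qed.

(** A half-edge at [f y] lies at an extremity of its chain and so determines a half-edge of [H].
    Without zero chains [f] is injective, which places this half-edge at [y]. *)
Lemma model_deg_f : (forall c, 0 < l c) -> forall y, deg (f y) <= deg y.
Proof.
move=> lp y; rewrite /deg.
pose F (h : halfedge G) : halfedge H := (q h.1, o h.1 (+) h.2).
have Fr h : hsrc h = f y -> if o h.1 (+) h.2 then (r h.1).+1 = l (q h.1) else r h.1 = 0.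
  rewrite /hsrc (m_end M); have := m_lt M h.1.
  case: (_ (+) _) => /=; rewrite ?addn0 ?addn1 => rl E.
    apply/eqP; rewrite eqn_leq rl leqNgt; apply/negP=> rl2.
    by apply: (m_inner M (c := q h.1) (j := (r h.1).+1) (x := y)).
  case: (posnP (r h.1)) => // r0.
  by case: (m_inner M (c := q h.1) (j := r h.1) (x := y)) => //; rewrite r0.
have fI a b : f a = f b -> a = b.
  move=> /(m_zero M) /connectP[[|z s]] //= /andP[/existsP[c /and3P[]]].
  by rewrite inE eqn0Ngt lp.
have FI : {in [set h | hsrc h == f y] &, injective F}.
  move=> [h i] [h' i']; rewrite !inE => /eqP/Fr A /eqP/Fr B [Eq Ei]; move: A B; rewrite /= -Ei -Eq.
  have : forall b : bool, (if b then (r h).+1 = l (q h) else r h = 0) ->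
    (if b then (r h').+1 = l (q h) else r h' = 0) -> r h = r h' by case; lia.
  move=> A B C; have Er := A _ B C; have Eh := m_inj M Eq Er; subst h'.
  by move: Ei => /addbI->.
rewrite -(card_in_imset FI); apply: subset_leq_card; apply/subsetP=> _ /imsetP[h hy ->].
move: hy; rewrite !inE => /eqP hy; have := Fr _ hy; move: hy; rewrite /hsrc (m_end M) /=.
case: (_ (+) _) => /= E Er; apply/eqP/fI.
  by rewrite -(m_pl M) -Er -E addn1.
by rewrite -(m_p0 M) -E Er.
Qed.

Lemma model_inner_half c j g i : 0 < j < l c ->
  endv g i = p c j -> q g = c /\ r g + (o g (+) i) = j.
Proof.
move=> jl; rewrite (m_end M) => E; have := m_lt M g => rl.
have [A|B] := boolP (0 < r g + (o g (+) i) < l (q g)); first exact: (m_pinj M A jl E).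
have : r g + (o g (+) i) = 0 \/ r g + (o g (+) i) = l (q g).
  by move: B rl; case: (_ (+) _); lia.
by case=> E2; rewrite E2 ?(m_p0 M) ?(m_pl M) in E; case: (m_inner M jl (esym E)).
Qed.

Lemma model_deg_inner c j : 0 < j < l c -> deg (p c j) = 2.
Proof.
move=> jl; have [g [gc gj]] : exists g, q g = c /\ r g = j by apply: (m_surj M); lia.
have [g' [gc' gj']] : exists g, q g = c /\ r g = j.-1 by apply: (m_surj M); lia.
rewrite /deg (_ : [set _ | _] = [set (g, o g); (g', ~~ o g')]).
  rewrite cards2 xpair_eqE (_ : (g == g') = false) //; apply/eqP => E.
  by move: gj'; rewrite -E gj; lia.
apply/setP=> -[h i]; rewrite !inE; apply/eqP/orP => [E|].
  have [/= hc] := model_inner_half jl E.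
  have [Eo|Eo] := boolP (o h (+) i) => hj.
    right; have -> : h = g' by apply: (m_inj M); rewrite ?hc // gj' -hj addn1.
    rewrite xpair_eqE eqxx /=; have <- : h = g' by apply: (m_inj M); rewrite ?hc // gj' -hj addn1.
    by move: Eo; case: (o h); case: (i).
  left; have -> : h = g by apply: (m_inj M); rewrite ?hc // gj -hj addn0.
  rewrite xpair_eqE eqxx /=; have <- : h = g by apply: (m_inj M); rewrite ?hc // gj -hj addn0.
  by move: Eo; case: (o h); case: (i).
case=> /eqP[-> ->]; rewrite /hsrc /= (m_end M).
  by rewrite addbb addn0 gc gj.
by rewrite gc' gj' addbN addbb addn1 prednK //; lia.
Qed.

Lemma model_deg_le3 : cubic H -> (forall c, 0 < l c) -> forall w : vert G, deg w <= 3.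
Proof.
move=> cH lp w; case: (m_cov M w) => [[x ->]|[c [j [jl ->]]]].
  by rewrite -(cH x); apply: model_deg_f.
have [->|j0] := posnP j; first by rewrite (m_p0 M) -(cH (endv c false)); apply: model_deg_f.
move: jl; rewrite leq_eqVlt => /orP[/eqP->|jl].
  by rewrite (m_pl M) -(cH (endv c true)); apply: model_deg_f.
by rewrite model_deg_inner ?j0.
Qed.

(** The edges of the common chain, listed by position, form a [chain_path]; if it closes up, only
    its two extremities coincide. *)
Lemma model_chain e e' : q e = q e' ->
  exists2 C : {set edge G}, chain_edges C & [set e; e'] \subset C.
Proof.
move=> Eq; set c := q e.
pose t j := odflt e [pick g | (q g == c) && (r g == j)].
have tP j : j < l c -> q (t j) = c /\ r (t j) = j.
  rewrite /t => /(m_surj M)[g [gc gj]].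
  by case: pickP => [h /andP[/eqP-> /eqP->]//|/(_ g)]; rewrite gc gj !eqxx.
have tr g : q g = c -> t (r g) = g.
  by move=> gc; have [|A B] := tP (r g); [rewrite -gc (m_lt M)|apply: (m_inj M); rewrite ?gc].
pose F j : halfedge G := (t j, o (t j)).
have Fs j : j < l c -> hsrc (F j) = p c j.
  by move=> /tP[A B]; rewrite /hsrc (m_end M) addbb addn0 A B.
have Ft j : j < l c -> htgt (F j) = p c j.+1.
  by move=> /tP[A B]; rewrite /htgt (m_end M) addbN addbb addn1 A B.
have lc : 0 < l c by apply: leq_ltn_trans (m_lt M e).
exists [set g | g \in [seq h.1 | h <- mkseq F (l c)]]; last first.
  apply/subsetP=> g; rewrite !inE => gE.
  have gc : q g = c by case/orP: gE => /eqP->.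
  apply/mapP; exists (F (r g)); last by rewrite /= tr.
  by apply: map_f; rewrite mem_iota /= -gc (m_lt M).
exists (mkseq F (l c)) => //; apply/and5P; split.
- by rewrite -size_eq0 size_mkseq -lt0n.
- apply/(sortedP (F 0)) => i; rewrite size_mkseq => il.
  by rewrite !nth_mkseq ?(ltnW il) // /consec Ft ?Fs ?(ltnW il).
- rewrite -map_comp map_inj_in_uniq ?iota_uniq // => i j; rewrite !mem_iota /= add0n => il jl E.
  by have [_ <-] := tP _ il; have [_ <-] := tP _ jl; rewrite E.
- rewrite -map_comp map_inj_in_uniq ?iota_uniq // => i j; rewrite !mem_iota /= add0n => il jl.
  rewrite !Fs //; have [->|i0] := posnP i; have [->|j0] := posnP j => //.
  + by rewrite (m_p0 M) => /esym/(m_inner M); rewrite j0 jl => /(_ erefl).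
  + by rewrite (m_p0 M) => /(m_inner M); rewrite i0 il => /(_ erefl).
  + by move=> /(m_pinj M)[||//]; rewrite ?i0 ?j0.
apply/andP; split.
- rewrite -map_comp map_inj_in_uniq ?iota_uniq // => i j; rewrite !mem_iota /= add0n => il jl.
  rewrite !Ft //; have [Ei|Ei] := eqVneq i.+1 (l c); have [Ej|Ej] := eqVneq j.+1 (l c).
  + by move=> _; lia.
  + by rewrite Ei (m_pl M) => /esym/(m_inner M) C; exfalso; apply: C; nat_lia.
  + by rewrite Ej (m_pl M) => /(m_inner M) C; exfalso; apply: C; nat_lia.
  + by move=> /(m_pinj M) C; have [||_ []//] := C; nat_lia.
- apply/allP => h; rewrite /mkseq; case E : (l c) lc => [//|n] _ /= /mapP[i].
  rewrite mem_iota => /andP[i0 il] ->.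
  by rewrite Fs ?model_deg_inner // E; rewrite ?i0 //; move: il; rewrite add1n.
Qed.

End ModelCuts.

(** Induction on the number of edges outside [C], deciding maximality classically. *)
Lemma chain_extends (G : mgraph) (C : {set edge G}) :
  chain_edges C -> exists2 C', positive_chain C' & C \subset C'.
Proof.
have [n] := ubnP (#|edge G| - #|C|); elim: n C => // n IH C Cn cC.
have [m|nm] := classic (forall C' : {set edge G}, chain_edges C' -> C \subset C' -> C' = C).
  by exists C.
have [C' nC'] := not_all_ex_not _ _ nm.
have [cC' nC2] := imply_to_and _ _ nC'; have [sC neC] := imply_to_and _ _ nC2.
have ltC : #|C| < #|C'|.
  apply: proper_card; rewrite properEneq sC andbT; apply/eqP => E; exact: neC.
have [|//|C'' pC sC''] := IH C'; first by apply: (@leq_trans (#|edge G| - #|C|)) => //; apply: ltn_sub2l => //; apply: leq_trans ltC (max_card _).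
by exists C'' => //; apply: subset_trans sC''.
Qed.

Lemma sbond2_cut (G : mgraph) (B : {set edge G}) :
  sbond 2 B -> exists a b, [/\ a <> b, B = [set a; b] & cut B].
Proof.
case/andP=> /minsetp Bc /cards2P[a [b [/eqP ab BE]]]; exists a, b; split=> //.
Qed.

Lemma cut2_sbond (G : mgraph) (B : {set edge G}) :
  cutge G 2 -> cut B -> #|B| = 2 -> sbond 2 B.
Proof.
move=> h cB B2; rewrite /sbond B2 eqxx andbT; apply/minsetP; split=> // C cC CB.
apply/eqP; rewrite eqEcard CB B2; exact: cutge_cards cC.
Qed.

(** [H] may have 2-cuts as long as one of their edges has length 0. This serves (a), where there are
    none, and (b), where lengths have been concentrated. *)
Lemma model_trivial (H G : mgraph) (l : edge H -> nat) (q : edge G -> edge H) :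
  modeled l q ->
  (forall a b, a <> b -> cut [set a; b] -> l a = 0 \/ l b = 0) ->
  forall B : {set edge G}, sbond 2 B -> trivial_2bond B.
Proof.
move=> [r [o [f [p M]]]] h B /sbond2_cut[a [b [ab -> cB]]].
have [Eq|/eqP nq] := eqVneq (q a) (q b).
  have [C cC sC] := model_chain M Eq; have [C' pC sC'] := chain_extends cC.
  by exists C' => //; apply: subset_trans sC'.
have := m_lt M a; have := m_lt M b.
by have [->|->] := h _ _ nq (cut_model M nq cB).
Qed.

(** * Edges in series *)

Definition incident (G : mgraph) (e : edge G) x := [exists i, endv e i == x].

(** Its [connect] closure stands in for lying on a common positive chain, and passes more easily
    through contractions. *)
Definition serial (G : mgraph) : rel (edge G) :=
  fun a b => [exists x, [&& deg x == 2, incident a x & incident b x]].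

Lemma serial_csym (G : mgraph) : connect_sym (@serial G).
Proof.
apply: sym_connect_sym => a b.
by apply/existsP/existsP => -[x /and3P[? ? ?]]; exists x; apply/and3P.
Qed.

Lemma trivial_2bond_serial (G : mgraph) a b :
  trivial_2bond [set a; b] -> connect (@serial G) a b.
Proof.
move=> [C [[s /and5P[_ so _ _ /andP[_ dg]] CE] _] sub].
have aC : a \in [seq h.1 | h <- s] by move/subsetP: sub => /(_ a); rewrite CE !inE eqxx; apply.
have bC : b \in [seq h.1 | h <- s].
  by move/subsetP: sub => /(_ b); rewrite CE !inE eqxx orbT; apply.
case: s {CE} so dg aC bC => // h s so dg.
have P e : e \in [seq h.1 | h <- h :: s] -> connect (@serial G) h.1 e.
  elim: s h so dg => [|h' s IH] h /=; first by rewrite inE => _ _ /eqP->.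
  case/andP=> /eqP hh so /andP[dg ds]; rewrite inE => /orP[/eqP->//|eS].
  apply: connect_trans (connect1 _) (IH h' so ds eS).
  apply/existsP; exists (hsrc h'); rewrite dg /incident /=; apply/andP; split; apply/existsP.
    by exists (~~ h.2); rewrite -hh.
  by exists h'.2.
by move=> /P ha /P hb; apply: connect_trans hb; rewrite serial_csym.
Qed.

(** * Expansion and vertex splitting *)

Section Expand.
Variables (G : mgraph) (v : vert G) (S : {set halfedge G}).
Local Notation K := (expand v S).
Local Notation N := (None : edge K).

Lemma expand_nonloop : endv N false != endv N true.
Proof. by []. Qed.

Lemma expand_contract :
  exists (a : vert (contract [set N]) -> vert G) (b : edge (contract [set N]) -> edge G),
  [/\ bijective a, bijective b,
      forall e, exists s, forall i, a (endv e i) = endv (b e) (s (+) i) &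
      forall u, val u = Some (b u)].
Proof.
have /fin_all_exists[b bE] : forall u : edge (contract [set N]), exists e, val u = Some e.
  by move=> [[e|] eP]; [exists e|exfalso; move: eP; rewrite inE eqxx].
pose strip (z : vert K) : vert G := if z is Some w then w else v.
pose a (u : vert (contract [set N])) := strip (val u).
have ends z : is_end N z -> strip z = v by case/orP=> /eqP->.
have aP z : a (contract_proj [set N] z) = strip z.
  have /eqP := contract_proj_val (contract_proj [set N] z : vert (contract [set N])).
  by rewrite contract1_proj_eq => /orP[/eqP E|/andP[/ends + /ends ->]]; rewrite /a ?E.
have Nv : is_end N (Some v) by apply: (is_end_endv N false).
have NN : is_end N None by apply: (is_end_endv N true).
exists a, b; split=> //.
- apply: inj_surj_bij => [u w|x]; last by exists (contract_proj [set N] (Some x)); rewrite aP.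
  rewrite /a => E; rewrite -[u]contract_proj_val -[w]contract_proj_val; apply/eqP; rewrite contract1_proj_eq.
  case: (val u) E => [x|]; case: (val w) => [y|] /=.
  + by move=> ->; rewrite eqxx.
  + by move=> ->; rewrite Nv NN.
  + by move=> <-; rewrite Nv.
  + by [].
- apply: inj_surj_bij => [u w E|e]; first by apply: val_inj; rewrite !bE E.
  have eN : (Some e : edge K) \notin [set N] by rewrite inE.
  by exists (exist _ (Some e : edge K) eN); have [] := bE (exist _ (Some e : edge K) eN).
- move=> u; exists false => i; rewrite aP bE addFb /=.
  by case: ifP => //= /andP[/eqP->].
Qed.

Lemma expand_iso : iso (contract [set N]) G.
Proof. by have [a [b [ba bb ab _]]] := expand_contract; exists a, b. Qed.

Lemma card_vert_expand : #|vert K| = #|vert G|.+1.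
Proof. by rewrite card_option. Qed.

Lemma card_edge_expand : #|edge K| = #|edge G|.+1.
Proof. by rewrite card_option. Qed.

End Expand.

(** * Splitting a vertex without creating small cuts *)

Section Split.
Variables (G : mgraph) (v : vert G).
Hypothesis c3 : cutge G 3.

(* Splitting off two half-edges with edges [a0] and [a1] changes the cut of a set
   avoiding [v] into its symmetric difference with [[set a0; a1]]. *)
Lemma tight_set_of_bad_split a0 i0 a1 i1 :
  a0 <> a1 -> endv a0 i0 = v -> endv a1 i1 = v ->
  ~~ cutge (expand v [set (a0, i0); (a1, i1)]) 3 ->
  exists X : {set vert G}, [/\ v \notin X, #|crossing X| = 3, a0 \in crossing X & a1 \in crossing X].
Proof.
set S := [set _; _]; move=> a01 e0 e1 /negP bad.
apply: NNPP => NX; apply: bad; apply/cutgeP => X' x y xX yX.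
have K3 : cutge (contract [set (None : edge (expand v S))]) 3.
  by apply: iso_cutge c3; apply: iso_sym; apply: expand_iso.
have [NC|NC] := boolP ((None : edge (expand v S)) \in crossing X'); last first.
  apply: (cutge_noncontracted K3 xX yX) => e eX; rewrite inE.
  by apply: contraNneq NC => <-.
wlog NX' : X' x y xX yX NC / None \in X'.
  move=> W; have [h|h] := boolP (None \in X'); first exact: (W X' x y).
  rewrite -crossingC; apply: (W (~: X') y x); rewrite ?crossingC //.
  - by rewrite inE.
  - by rewrite inE negbK.
  - by rewrite inE.
have vX' : Some v \notin X'.
  by move: NC; rewrite inE /= NX'; case: (_ \in X').
pose X := [set w | Some w \in X'].
have vX : v \notin X by rewrite inE.
have CE e : ((Some e : edge (expand v S)) \in crossing X') = (e \in symd (crossing X) [set a0; a1]).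
  have A i : ((endv (Some e : edge (expand v S)) i) \in X') =
      (endv e i \in X) (+) ((e, i) \in S).
    have -> : (endv e i \in X) = (Some (endv e i) \in X') by rewrite inE.
    rewrite /=; case: eqP => [E|E] /=; last first.
      have -> : (e, i) \in S = false by
        apply/negP; rewrite !inE => /orP[]/eqP[E1 E2]; apply: E; rewrite E1 E2.
      by rewrite addbF.
    by case: ((e, i) \in S); rewrite E (negbTE vX') ?NX'.
  have SE i : ((e, i) \in S) = ((e == a0) && (i == i0)) || ((e == a1) && (i == i1)).
    by rewrite !inE !xpair_eqE.
  have XE : (e \in crossing X) = ((endv e false \in X) != (endv e true \in X)) by rewrite inE.
  rewrite inE !A !SE [RHS]in_set in_set2 XE.
  have : ~~ ((e == a0) && (e == a1)) by apply/negP=> /andP[/eqP-> /eqP].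
  move: (e == a0) (e == a1) (endv e false \in X) (endv e true \in X).
  by case: (i0); case: (i1); do 4!case.
have CX : crossing X' = None |: Some @: symd (crossing X) [set a0; a1].
  apply/setP=> -[e|]; last by rewrite NC !inE eqxx.
  by rewrite CE in_setU1 (mem_imset _ _ (@Some_inj _)).
rewrite CX cardsU1 (_ : None \notin _) /=; last by apply/negP=> /imsetP[].
rewrite card_imset ?add1n; last exact: Some_inj.
rewrite ltnS ltnNge; apply/negP => small; apply: NX; exists X.
have [X0|/set0Pn[z zX]] := eqVneq X set0.
  move: small; rewrite X0 crossing0 (_ : symd _ _ = [set a0; a1]); last first.
    by apply/setP=> e; rewrite !inE.
  by rewrite cards2; case: eqP.
have c3X : 3 <= #|crossing X| by move/cutgeP: c3 => h; apply: (h _ z v).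
(* The symmetric difference has at most one edge and [crossing X] at least three, so [crossing X]
   has exactly three and contains both [a0] and [a1]. *)
have U : #|crossing X| <= #|symd (crossing X) [set a0; a1]| + #|crossing X :&: [set a0; a1]|.
  apply: leq_trans (leq_card_setU _ _); apply: subset_leq_card.
  by apply/subsetP=> e eX; rewrite in_setU in_setI [_ \in symd _ _]in_set eX; case: (e \in [set _; _]).
have I2 : #|crossing X :&: [set a0; a1]| <= #|[set a0; a1]| by apply: subset_leq_card (subsetIr _ _).
have n2 : #|[set a0; a1]| = 2 by rewrite cards2; case: eqP.
have I2' : crossing X :&: [set a0; a1] = [set a0; a1].
  by apply/eqP; rewrite eqEcard subsetIr; lia.
split=> //; first by lia.
  by move/setP/(_ a0): I2'; rewrite !in_setI !in_set2 eqxx andbT.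
by move/setP/(_ a1): I2'; rewrite !in_setI !in_set2 eqxx orbT andbT.
Qed.

(** If no two half-edges at [v] can be split off, any two distinct edges at [v] lie in a common
    3-cut. Uncrossing merges such cuts into a 3-cut containing four edges at [v]. *)
Lemma split_vertex : 4 <= deg v -> exists S, cutge (expand v S) 3.
Proof.
move=> d4; apply: NNPP => NS.
have bad a0 i0 a1 i1 : a0 <> a1 -> endv a0 i0 = v -> endv a1 i1 = v ->
  exists X : {set vert G}, [/\ v \notin X, #|crossing X| = 3, a0 \in crossing X & a1 \in crossing X].
  move=> ne e0 e1; apply: (@tight_set_of_bad_split a0 i0 a1 i1) => //; apply/negP => h; apply: NS.
  by exists [set (a0, i0); (a1, i1)].
(* Without loops at [v], the set [Y] accounts for at most three of the four or more half-edges at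
   [v]. *)
have new (Y : {set edge G}) : (forall a, endv a false = v -> endv a true = v -> a \notin Y) ->
    #|Y| <= 3 -> exists a i, a \notin Y /\ endv a i = v.
  move=> nl Y3; apply: NNPP => NY.
  have hY (h : halfedge G) : hsrc h = v -> h.1 \in Y.
    by move=> hv; apply: contraT => hn; case: NY; exists h.1, h.2.
  have I : {in [set h : halfedge G | hsrc h == v] &, injective (fun h : halfedge G => h.1)}.
    move=> [a i] [b j]; rewrite !inE => /eqP A /eqP B /= E; subst b.
    have [->//|ij] := eqVneq i j.
    have := hY _ A; rewrite (negbTE (nl a _ _)) //; move: A B ij; rewrite /hsrc /=;
      by case: i j => [] [].
  suff : deg v <= #|Y| by lia.
  rewrite /deg -(card_in_imset I); apply: subset_leq_card; apply/subsetP=> _ /imsetP[h hv ->].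
  by apply: hY; move: hv; rewrite inE => /eqP.
have [[a0 i0] h0] : exists h : halfedge G, hsrc h = v.
  have /card_gt0P[h] : 0 < deg v by lia.
  by rewrite inE => /eqP; exists h.
have ncr (Y : {set vert G}) a : v \notin Y -> endv a false = v -> endv a true = v -> a \notin crossing Y.
  by move=> vY E1 E2; rewrite inE E1 E2 eqxx.
(* The union of two tight sets sharing the edge [a0] is tight by submodularity, so
   a tight set can absorb more and more edges at [v]. *)
have Q m : exists Y : {set vert G}, [/\ v \notin Y, #|crossing Y| = 3, a0 \in crossing Y &
    m <= #|[set a in crossing Y | incident a v]|].
  elim: m => [|m [Y [vY Y3 aY mY]]].
    have [a1 [i1 [ne e1]]] : exists a i, a <> a0 /\ endv a i = v.
      apply: NNPP => NA; have hh (h : halfedge G) : hsrc h = v -> h.1 = a0.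
        by move=> hv; apply: NNPP => ne; apply: NA; exists h.1, h.2.
      suff : deg v <= 2 by lia.
      have <- : #|[set (a0, false); (a0, true)]| = 2 by rewrite cards2 xpair_eqE andbF.
      apply: subset_leq_card; apply/subsetP=> -[a i]; rewrite !inE => /eqP/hh /= ->.
      by rewrite !xpair_eqE eqxx; case: (i).
    have [X [vX X3 aX _]] := bad a0 i0 a1 i1 (nesym ne) h0 e1.
    by exists X.
  have [||a [i [aN ai]]] := new (crossing Y); first by move=> a; apply: ncr.
    by rewrite Y3.
  have ne : a0 <> a by move=> E; rewrite -E aY in aN.
  have [X [vX X3 a0X aX]] := bad a0 i0 a i ne h0 ai.
  have vU : v \notin Y :|: X by rewrite inE negb_or vY vX.
  have other (Z : {set vert G}) b j : v \notin Z -> endv b j = v -> b \in crossing Z -> endv b (~~ j) \in Z.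
    by move=> vZ bj; rewrite (in_crossing _ _ j) bj (negbTE vZ); case: (_ \in Z).
  have z0Y := other _ _ _ vY h0 aY; have z0X := other _ _ _ vX h0 a0X.
  have nb (Z : {set vert G}) b j : v \notin Z -> endv b j = v -> endv b (~~ j) \in Z -> b \in crossing Z.
    by move=> vZ bj bZ; rewrite (in_crossing _ _ j) bj bZ (negbTE vZ).
  (* The far end of [a0] is in both sets and [v] in neither, so union and intersection both define
     cuts of size at least 3, and submodularity forces equality. *)
  have U3 : 3 <= #|crossing (Y :|: X)|.
    by move/cutgeP: c3 => h; apply: (h _ (endv a0 (~~ i0)) v) => //; rewrite inE z0Y.
  have I3 : 3 <= #|crossing (Y :&: X)|.
    move/cutgeP: c3 => h; apply: (h _ (endv a0 (~~ i0)) v); first by rewrite inE z0Y z0X.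
    by rewrite inE negb_and vY.
  have sub := crossing_submod Y X.
  exists (Y :|: X); split=> //; first by lia.
    by apply: (nb _ _ i0) => //; rewrite inE z0Y.
  apply: leq_ltn_trans mY _; apply: proper_card; apply/properP; split.
    apply/subsetP=> b; rewrite in_set => /andP[bY bv]; rewrite in_set bv andbT.
    have /existsP[j /eqP bj] := bv.
    by apply: (nb _ _ j) => //; rewrite inE (other _ _ _ vY bj).
  exists a; last by rewrite in_set (negbTE aN).
  rewrite in_set; apply/andP; split; last by apply/existsP; exists i; rewrite ai.
  by apply: (nb _ _ i) => //; rewrite inE (other _ _ _ vX ai) ?orbT.
have [Y [_ Y3 _ +]] := Q 4.
have : #|[set a in crossing Y | incident a v]| <= #|crossing Y|.
  by apply: subset_leq_card; apply/subsetP=> b; rewrite in_set => /andP[].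
lia.
Qed.

End Split.

(** * Degree counts and vertices of degree 2 *)

Section Degrees.
Variable G : mgraph.

Lemma sum_deg : \sum_(v : vert G) deg v = 2 * #|edge G|.
Proof.
rewrite /deg (eq_bigr (fun v => \sum_(h : halfedge G) (hsrc h == v))); last first.
  move=> v _; rewrite -sum1_card big_mkcond; apply: eq_bigr => h _.
  by rewrite inE; case: eqP.
rewrite exchange_big /= (eq_bigr (fun=> 1)); last first.
  move=> h _; rewrite (bigD1 (hsrc h)) //= eqxx big1 // => v.
  by rewrite eq_sym => /negbTE->.
by rewrite sum1_card card_prod card_bool mulnC.
Qed.

(** The edges leaving [v] form a cut if there is another vertex. Otherwise all [1 + k] edges are
    loops at [v] and its degree is at least 4, whence the bound on [s]. *)
Lemma cutge_deg s k (v : vert G) : cutge G s -> s <= 4 -> 0 < k ->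
  #|edge G| = #|vert G| + k -> s <= deg v.
Proof.
move=> /cutgeP h s4 k0 EV.
have [/existsP[w wv]|/existsPn nw] := boolP [exists w, w != v].
  apply: leq_trans (h [set v] v w _ _) _; rewrite ?inE //.
  apply: leq_trans (leq_imset_card (fun h : halfedge G => h.1) _).
  apply: subset_leq_card; apply/subsetP => e; rewrite !inE.
  case: (endv e false =P v) => [E _|_]; first by apply/imsetP; exists (e, false); rewrite ?inE /hsrc /= ?E ?eqxx.
  case: (endv e true =P v) => // [E _]; by apply/imsetP; exists (e, true); rewrite ?inE /hsrc /= ?E ?eqxx.
have V1 : #|vert G| = 1.
  apply/eqP/fintype1P; exists v => w; apply/eqP; exact: contraNT (nw w).
have := sum_deg; rewrite (bigD1 v) //= big1; last first.
  by move=> w wv; move: (nw w); rewrite wv.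
rewrite addn0 => ->; rewrite EV V1 mulnDr.
by apply: leq_trans s4 _; rewrite (leq_add2l 2 2) -{1}[2]muln1 leq_mul2l.
Qed.

Lemma series_of_deg2 (x : vert G) e i0 :
  deg x = 2 -> endv e i0 = x -> endv e false != endv e true ->
  exists g i1, series_vertex x e g i0 i1.
Proof.
move=> dx ex nl.
have hx : (e, i0) \in [set h : halfedge G | hsrc h == x] by rewrite inE /hsrc /= ex.
have : #|[set h : halfedge G | hsrc h == x] :\ (e, i0)| = 1.
  by apply/esym; have := cardsD1 (e, i0) [set h : halfedge G | hsrc h == x]; rewrite hx -/(deg x) dx add1n => -[].
move/eqP/cards1P=> [[g i1] E].
have gP : (g, i1) \in [set h : halfedge G | hsrc h == x] :\ (e, i0) by rewrite E inE.
move: gP; rewrite !inE => /andP[ne /eqP gx].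
exists g, i1; split=> //.
  move=> eg; subst g; case/eqP: ne; congr (_, _).
  move: gx ex nl; rewrite /hsrc /=; case: i0 i1 {hx E} => [] [] //= -> ->; by rewrite eqxx.
move=> h i hi; have [->|nh] := eqVneq (h, i) (e, i0); first by left.
by right; apply/set1P; rewrite -E !inE nh /hsrc /= hi eqxx.
Qed.

(** A loop at [x] would exhaust its degree, so [x] would be the only vertex; but then the [1 + k]
    edges give it degree at least 4. *)
Lemma series_exists k (x : vert G) : cutge G 2 -> 0 < k ->
  #|edge G| = #|vert G| + k -> deg x = 2 ->
  exists e g i0 i1, series_vertex x e g i0 i1.
Proof.
move=> c2 k0 EV dx.
have /card_gt0P[[e i0]] : 0 < deg x by rewrite dx.
rewrite inE => /eqP ex; have [nl|] := boolP (endv e false != endv e true).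
  by have [g [i1 S]] := series_of_deg2 dx ex nl; exists e, g, i0, i1.
rewrite negbK => /eqP lp; exfalso.
have ei i : endv e i = x by move: ex lp; rewrite /hsrc /=; case: i0 i => [] [] //= -> // ->.
have hx : [set h : halfedge G | hsrc h == x] = [set (e, false); (e, true)].
  apply/esym/eqP; rewrite eqEcard -/(deg x) dx cards2 xpair_eqE andbF andbT.
  by apply/subsetP=> h; rewrite !inE => /orP[]/eqP->; rewrite /hsrc ei.
have [/existsP[w wx]|/existsPn nw] := boolP [exists w, w != x].
  have := (cutgeP _ _ c2) [set x] x w; rewrite !inE eqxx => /(_ isT wx).
  rewrite (_ : crossing _ = set0) ?cards0 //; apply/setP=> h; rewrite [RHS]in_set0.
  apply/negP => hX; have [i hi] : exists i, endv h i = x.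
    move: hX; rewrite !inE; case: (endv h false =P x) => [E _|_]; first by exists false.
    by case: (endv h true =P x) => [E _|//]; exists true.
  have : (h, i) \in [set h : halfedge G | hsrc h == x] by rewrite inE /hsrc /= hi.
  by rewrite hx !inE => /orP[]/eqP[hE _]; move: hX; rewrite hE inE !ei eqxx.
have V1 : #|vert G| = 1.
  apply/eqP/fintype1P; exists x => w; apply/eqP; exact: contraNT (nw w).
have := sum_deg; rewrite (bigD1 x) //= big1; last first.
  by move=> w wv; move: (nw w); rewrite wv.
by rewrite dx addn0 EV V1; lia.
Qed.

End Degrees.

(** * Distillable graphs *)

(** Working form of [has_weak_distillation_in_Dk], with a model instead of an isomorphism. *)
Definition distillable k (G : mgraph) :=
  exists D (l : edge D -> nat) (q : edge G -> edge D),
    [/\ in_Dk k D, modeled l q & no_zero_cycle l].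

Lemma distillable_has_weak_distillation k G : distillable k G -> has_weak_distillation_in_Dk k G.
Proof.
move=> [D [l [q [DD M nz]]]]; exists D => //; split; first by case: DD.
by exists l; split=> //; apply: modeled_iso_weak_subdivision M.
Qed.

Lemma chain_lengths_modeled (D G : mgraph) (l : edge D -> nat) :
  chain_lengths G l -> exists q : edge G -> edge D, modeled l q.
Proof. by move=> [_ GW]; have [q M] := modeled_weak_subdivision l; apply: iso_modeled M. Qed.

Lemma distillable_iso k G G1 : iso G1 G -> distillable k G -> distillable k G1.
Proof.
move=> I [D [l [q [DD M nz]]]]; have [q1 M1] := iso_modeled I M.
by exists D, l, q1.
Qed.

Lemma distillable_contract k K (e : edge K) : endv e false != endv e true ->
  distillable k K -> distillable k (contract [set e]).
Proof.
move=> nl [D [l [q [DD M nz]]]].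
exists D, (fun c => l c - (c == q e)), (fun u => q (val u)); split=> //.
  exact: modeled_contract.
exact: no_zero_cycle_contract nz.
Qed.

Lemma distillable_subdivide k K x (e g : edge K) i0 i1 : series_vertex x e g i0 i1 ->
  distillable k (contract [set e]) -> distillable k K.
Proof.
move=> S [D [l [q [DD M nz]]]].
have gF : g \notin [set e] by have [ne _ _ _] := S; rewrite inE eq_sym; apply/eqP.
have [q' [M' _ _]] := modeled_subdivide S gF M.
exists D, (fun c => l c + (c == q (exist _ g gF))), q'; split=> // c /nz lc.
by apply: leq_trans lc _; apply: leq_sum => h _; apply: leq_addr.
Qed.

(** Minimum degree 3 bounds the number of vertices by [2 * k], with equality only for cubic graphs.
    Splitting adds one vertex and one edge, so the induction is on the remaining gap. *)
Lemma cutge3_distillable k G : 0 < k -> 0 < #|vert G| -> cutge G 3 ->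
  #|edge G| = #|vert G| + k -> distillable k G.
Proof.
move=> k0; have [m] := ubnP (2 * k - #|vert G|); elim: m G => // m IH G Gm V0 c3 EV.
have d3 (v : vert G) : 3 <= deg v by exact: (cutge_deg v c3 isT k0 EV).
have [/forallP cub|/forallPn[v dv]] := boolP [forall v : vert G, deg v == 3].
  exists G, (fun=> 1), id; split; last 2 first.
  - exact: modeled_id.
  - move=> c /and4P[]; case: c => // h c _ _ _ _.
    by rewrite big_cons.
  have V2 : #|vert G| = 2 * k.
    have := sum_deg G; rewrite (eq_bigr (fun=> 3)); last by move=> v _; apply/eqP.
    rewrite sum_nat_const EV => E; have {}E : #|vert G| * 3 = 2 * (#|vert G| + k) := E.
    by move: (#|vert G|) E; lia.
  split=> //; first by move=> v; apply/eqP.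
    by apply/edge_connectedP.
  by rewrite EV V2; lia.
have d4 : 4 <= deg v by rewrite ltn_neqAle eq_sym dv d3.
have [S cS] := split_vertex c3 d4.
have Vk : #|vert G| < 2 * k.
  have : 3 * #|vert G| < \sum_(v : vert G) deg v.
    rewrite (bigD1 v) //= -sum1_card (bigD1 v) //= mulnDr big_distrr /=.
    rewrite -addSn; apply: leq_add => //.
    by apply: leq_sum => w _; rewrite muln1.
  by rewrite sum_deg EV; lia.
(* [G] is recovered from the expansion by contracting the new edge. *)
apply: distillable_iso (iso_sym (expand_iso v S)) _.
apply: distillable_contract; first exact: expand_nonloop.
by apply: IH => //; rewrite ?card_vert_expand ?card_edge_expand ?EV //; lia.
Qed.

Definition series_cuts (G : mgraph) :=
  forall a b : edge G, cut [set a; b] -> connect (@serial G) a b.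

Lemma cut_contract (K : mgraph) (F : {set edge K}) (u v : edge (contract F)) :
  cut [set u; v] -> cut [set val u; val v].
Proof.
move=> /cutP[X [x [y [xX yX E]]]]; apply/cutP.
exists (contract_proj F @^-1: X), (val x), (val y).
by rewrite !inE !contract_proj_val crossing_preim -E imsetU !imset_set1.
Qed.

(** [rho] sends [e] to its neighbour [g]. A serial step at [x] then collapses, and the other end of
    [e] keeps its degree after merging since [x] has degree 2. *)
Lemma series_cuts_contract (K : mgraph) x (e g : edge K) i0 i1 :
  series_vertex x e g i0 i1 -> deg x = 2 -> series_cuts K ->
  series_cuts (contract [set e]).
Proof.
move=> S dx sc u v /cut_contract/sc; have nl := series_nonloop S.
have [/eqP ne ex gx hx] := S.
have gF : g \notin [set e] by rewrite inE eq_sym.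
pose g' : edge (contract [set e]) := exist _ g gF.
pose rho h : edge (contract [set e]) := insubd g' h.
have rhoK h : h != e -> val (rho h) = h by move=> he; rewrite val_insubd inE he.
have rhoe : rho e = g' by rewrite /rho /insubd insubF ?inE ?eqxx.
have rhoval w : rho (val w) = w by apply: val_inj; rewrite rhoK //; have := valP w; rewrite inE.
rewrite -{2}[u]rhoval -{2}[v]rhoval.
have inc h w : incident h w -> incident (rho h) (contract_proj [set e] w : vert (contract [set e])).
  move=> /existsP[i /eqP hw]; apply/existsP; have [E|he] := eqVneq h e.
    exists i1; rewrite E rhoe /= gx -hw E -ex.
    by apply/eqP; apply: contract1_proj_ends.
  by exists i; rewrite /= rhoK // hw.
have dg w : w <> x -> deg w = 2 -> deg (contract_proj [set e] w : vert (contract [set e])) = 2.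
  move=> wx dw; rewrite deg_contract1 //; case: ifP => // /is_endP[i Ew].
  have : deg (endv e i) = 2 by rewrite -Ew.
  have : deg (endv e i0) = 2 by rewrite ex.
  have : i <> i0 by move=> E; apply: wx; rewrite Ew E.
  by case: i i0 {S ex hx Ew} => [] [] // _ -> ->.
case/connectP=> s; elim: s {u} (val u) => [|b s IH] a /=; first by move=> _ ->.
case/andP=> /existsP[w /and3P[/eqP dw aw bw]] P E.
apply: connect_trans (IH _ P E).
have [wx|/eqP wx] := eqVneq w x; last first.
  apply/connect1/existsP; exists (contract_proj [set e] w).
  by rewrite (dg _ wx dw) eqxx !inc.
have R h : incident h w -> rho h = g'.
  rewrite wx => /existsP[i /eqP/hx[[-> _]|[-> _]]] //.
  by apply: val_inj; rewrite rhoK // eq_sym.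
by rewrite !R.
Qed.

(** Vertices of degree 2 are contracted away one at a time. Once none is left [serial] is empty, so
    no 2-cut remains. *)
Lemma series_cuts_distillable k G : 0 < k -> 0 < #|vert G| -> cutge G 2 ->
  #|edge G| = #|vert G| + k -> series_cuts G -> distillable k G.
Proof.
move=> k0; have [m] := ubnP #|vert G|; elim: m G => // m IH G Gm V0 c2 EV sc.
have [/existsP[x /eqP dx]|/existsPn nd] := boolP [exists x : vert G, deg x == 2].
  have [e [g [i0 [i1 S]]]] := series_exists c2 k0 EV dx; have nl := series_nonloop S.
  apply: (distillable_subdivide S).
  have EV1 := card_vert_contract1 nl; have EE1 := card_edge_contract1 e.
  apply: IH; [lia| |exact: contract_cutge|lia|exact: series_cuts_contract S dx sc].
  by apply/card_gt0P; exists (contract_proj [set e] x).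
apply: cutge3_distillable => //; apply/cutgeP => X x y xX yX.
have := (cutgeP _ _ c2) X x y xX yX; rewrite leq_eqVlt => /orP[|//].
rewrite eq_sym => /cards2P[a [b [ab E]]].
have : connect (@serial G) a b by apply: sc; apply/cutP; exists X, x, y.
case/connectP=> -[|c s] /=; first by move=> _ E2; rewrite E2 eqxx in ab.
by case/andP=> /existsP[z /and3P[dz]]; rewrite (negbTE (nd z)) in dz.
Qed.

Lemma trivial_distillable k G : 0 < k -> 0 < #|vert G| -> cutge G 2 ->
  #|edge G| = #|vert G| + k ->
  (forall B : {set edge G}, sbond 2 B -> trivial_2bond B) -> distillable k G.
Proof.
move=> k0 V0 c2 EV tr; apply: series_cuts_distillable => // a b cab.
have [->|ab] := eqVneq a b; first exact: connect0.
by apply: trivial_2bond_serial; apply: tr; apply: cut2_sbond => //; rewrite cards2 ab.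
Qed.

(** * Symmetric shifts and their invariants *)

Definition sym_shift (G H : mgraph) :=
  exists (K : mgraph) (e e' : edge K),
    [/\ e <> e', sbond 2 [set e; e'], iso G (contract [set e']) & iso H (contract [set e])].

Lemma shift_sym_shift G H : shift G H -> sym_shift G H.
Proof.
move=> [e [v [S /= [B I]]]]; exists (expand v S), (Some e), None; split=> //.
exact/iso_sym/expand_iso.
Qed.

Lemma sym_shift_sym G H : sym_shift G H -> sym_shift H G.
Proof.
by move=> [K [e [e' [ne B IG IH]]]]; exists K, e', e; split=> //; [apply: nesym|rewrite setUC].
Qed.

(* The definition of [equivalent] is one-directional on each side; symmetry of
   [sym_shift] makes the direction irrelevant. *)
Lemma shifts_invariant (I : mgraph -> Prop) :
  (forall G H, iso G H -> I G -> I H) -> (forall G H, sym_shift G H -> I G -> I H) ->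
  forall G H, equivalent G H -> I H -> I G.
Proof.
move=> Iiso Ish.
have P G H : shifts G H -> (I H -> I G) /\ (I G -> I H).
  elim=> [{}G {}H GH|{}G G' {}H /shift_sym_shift s _ [A B]].
    by split; apply: Iiso => //; apply: iso_sym.
  split=> [/A|/(Ish _ _ s)/B//]; apply: Ish; exact: sym_shift_sym.
by move=> G H [/P[]|/P[]].
Qed.

(** A cut of [K] that avoids [e] but uses [e'] is added to the 2-cut [{e, e'}]. The result has the
    same size and avoids [e'], so it is a cut of [G]. *)
Lemma cutge3_sym_shift G H : sym_shift G H -> cutge G 3 -> cutge H 3.
Proof.
move=> [K [e [e' [ne /andP[/minsetp/cutP[Z [_ [_ [_ _ EZ]]]] _] IG IH]]]] c3.
apply: iso_cutge (iso_sym IH) _; have {}c3 := iso_cutge IG c3.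
apply/cutgeP => X x y xX yX; rewrite -card_crossing_preim crossing_preim.
set Y := contract_proj [set e] @^-1: X; rewrite -crossing_preim -/Y.
have eY : e \notin crossing Y.
  by rewrite crossing_preim; apply/imsetP=> -[u _ E]; have := valP u; rewrite -E inE eqxx.
have [e'Y|e'Y] := boolP (e' \in crossing Y); last first.
  apply: (cutge_noncontracted c3 (x := val x) (y := val y)); rewrite ?inE ?contract_proj_val //.
  by move=> h hY; rewrite inE; apply: contraNneq e'Y => <-.
have CE : crossing (symd Y Z) = e |: (crossing Y :\ e').
  apply/setP=> h; rewrite crossing_symd -EZ in_set in_set2 in_setU1 in_setD1.
  have [->|he] := eqVneq h e; first by rewrite (negbTE eY).
  by have [->|he'] := eqVneq h e'; rewrite ?e'Y //= addbF.
have -> : #|crossing Y| = #|crossing (symd Y Z)|.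
  rewrite CE cardsU1 in_setD1 (negbTE eY) andbF [LHS](cardsD1 e') e'Y //.
have [a [b [aY bY]]] : exists x y, x \in symd Y Z /\ y \notin symd Y Z.
  by apply: (crossing_nontrivial (e := e)); rewrite CE !inE eqxx.
apply: (cutge_noncontracted c3 aY bY) => h; rewrite CE in_setU1 in_setD1 inE => /orP[/eqP->|/andP[]//].
by apply/eqP.
Qed.

(** All degrees in [G] are at most 3, so the degrees of the ends of [e'] add up to at most 5 and one
    of them is 2. Hence [K] only lengthens a chain of [G], and contracting [e] shortens the same
    chain. *)
Lemma positive_sym_shift G H D (l : edge D -> nat) (q : edge G -> edge D) :
  cubic D -> cutge D 3 -> (forall c, 0 < l c) -> sym_shift G H -> modeled l q ->
  exists q' : edge H -> edge D, modeled l q'.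
Proof.
move=> cD c3 lp [K [e [e' [ne B IG IH]]]] MG.
have /andP[bd _] := B; have /minsetP[cB minB] := bd.
have nl h : h \in [set e; e'] -> endv h false != endv h true.
  move/cutP: cB => [Z [_ [_ [_ _ ->]]]]; rewrite inE.
  by apply: contraNneq => ->.
have nle : endv e false != endv e true by apply: nl; rewrite !inE eqxx.
have nle' : endv e' false != endv e' true by apply: nl; rewrite !inE eqxx orbT.
have [q1 M1] := iso_modeled (iso_sym IG) MG.
(* An end of degree 1 would make [e'] a cut by itself, against the minimality of the bond. *)
have deg2 i : 2 <= deg (endv e' i).
  rewrite ltnNge; apply/negP=> d1.
  have hx h j : endv h j = endv e' i -> (h, j) = (e', i).
    move=> E; apply/eqP; apply: contraT => ne2.
    have : #|[set (h, j); (e', i)]| <= deg (endv e' i).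
      apply: subset_leq_card; apply/subsetP=> u; rewrite !inE /hsrc => /orP[]/eqP->//=.
      by rewrite E.
    by rewrite cards2 ne2; lia.
  have CX : crossing [set endv e' i] = [set e'].
    apply/setP=> h; rewrite in_set1; apply/idP/eqP => [hX|->].
      have [j hj] : exists j, endv h j = endv e' i.
        move: hX; rewrite !inE; case: (endv h false =P endv e' i) => [E _|_]; first by exists false.
        by case: (endv h true =P endv e' i) => [E _|//]; exists true.
      by have [] := hx _ _ hj.
    rewrite (in_crossing _ _ i) !inE eqxx; case: (i) => /=; last rewrite [endv _ _ == _]eq_sym.
      by rewrite (negbTE nle').
    by rewrite (negbTE nle').
  have c1 : cut [set e'] by rewrite -CX; apply: (@cut_crossing _ _ e'); rewrite CX inE.
  have := minB _ c1; rewrite subsetUr => /(_ isT)/setP/(_ e).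
  by rewrite !inE eqxx /= => /eqP.
have [x [i0 [ex dx]]] : exists x i0, endv e' i0 = x /\ deg x = 2.
  have [r1 [o1 [f1 [p1 Mo]]]] := M1.
  have := model_deg_le3 Mo cD lp (contract_proj [set e'] (endv e' false)).
  rewrite deg_contract1 // is_end_endv => d3.
  have df := deg2 false; have dt := deg2 true.
  have [E|E] : deg (endv e' false) = 2 \/ deg (endv e' true) = 2 by lia.
    by exists (endv e' false), false.
  by exists (endv e' true), true.
have [g [i1 S]] := series_of_deg2 dx ex nle'.
have gF : g \notin [set e'] by have [n2 _ _ _] := S; rewrite inE eq_sym; apply/eqP.
have [q' [M' qe' _]] := modeled_subdivide S gF M1.
(* Otherwise the bond would leave a 2-cut on the 3-edge-connected graph [D]. *)
have qq : q' e = q' e'.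
  apply: NNPP => nq; have [r1 [o1 [f1 [p1 Mo]]]] := M'.
  have := cutge_cards c3 (cut_model Mo nq cB); rewrite cards2; by case: (_ != _).
have M2 := modeled_contract e M'.
apply: (iso_modeled (G := contract [set e]) IH).
  apply: modeled_ext M2 => [c|u]; last reflexivity.
by rewrite /= qq qe' addnK.
Qed.

(** * Moving length between chains by shifts *)

Lemma series_crossing (K : mgraph) x (e g : edge K) i0 i1 :
  series_vertex x e g i0 i1 -> crossing [set x] = [set e; g].
Proof.
move=> [ne ex gx hx]; apply/setP=> h; rewrite !inE; apply/idP/orP.
  case: (endv h false =P x) => [/hx E|_].
    by case: E => -[-> _] _; rewrite eqxx; [left|right].
  by case: (endv h true =P x) => [/hx E|//]; case: E => -[-> _] _; rewrite eqxx; [left|right].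
have W a i b j : endv a i = x -> endv b j = x -> (forall i', endv a i' = x -> i' = i) ->
    (endv a false == x) != (endv a true == x).
  move=> ax bx u; case: (endv a false =P x) => [/u A|/eqP A]; case: (endv a true =P x) => [/u B|/eqP B] //.
    by rewrite -A in B.
  by move: ax A B; case: i {u} => ->; rewrite eqxx.
case=> /eqP->.
  by apply: (W e i0 g i1) => // i' /hx[[]//|[/ne]].
by apply: (W g i1 e i0) => // i' /hx[[/esym/ne]|[]].
Qed.

(** In a cut using [e] but not [g], moving [x] to the other side exchanges [e] for [g]. *)
Lemma series_cutge2 (K : mgraph) x (e g : edge K) i0 i1 :
  series_vertex x e g i0 i1 -> cutge (contract [set e]) 2 -> cutge K 2.
Proof.
move=> S c2; apply/cutgeP => X a b aX bX; have [ne _ _ _] := S.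
have [eX|eX] := boolP (e \in crossing X); last first.
  by apply: (cutge_noncontracted c2 aX bX) => h hX; rewrite inE; apply: contraNneq eX => <-.
have [gX|gX] := boolP (g \in crossing X).
  have <- : #|[set e; g]| = 2 by rewrite cards2; case: eqP.
  by apply: subset_leq_card; apply/subsetP=> h; rewrite in_set2 => /orP[]/eqP->.
have CE : crossing (symd X [set x]) = g |: (crossing X :\ e).
  apply/setP=> h; rewrite crossing_symd (series_crossing S) in_set in_set2 in_setU1 in_setD1.
  have [->|he] := eqVneq h e; first by rewrite eX /= orbF; apply/esym/negbTE/eqP.
  by have [->|hg] := eqVneq h g; rewrite ?(negbTE gX) //= addbF.
have -> : #|crossing X| = #|crossing (symd X [set x])|.
  by rewrite CE cardsU1 in_setD1 (negbTE gX) andbF [LHS](cardsD1 e) eX.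
have [c [d [cX dX]]] : exists c d, c \in symd X [set x] /\ d \notin symd X [set x].
  by apply: (crossing_nontrivial (e := g)); rewrite CE in_setU1 eqxx.
apply: (cutge_noncontracted c2 cX dX) => h; rewrite CE in_setU1 in_setD1 inE.
by case/orP=> [/eqP->|/andP[]//]; apply/eqP/nesym.
Qed.

(** The new edge subdivides an edge [g] on the chain of [b], and an edge [e] on the chain of [a] is
    contracted; these two form a 2-bond because [{e, g}] is a 2-cut. *)
Lemma shift_move (H G : mgraph) (l : edge H -> nat) (q : edge G -> edge H) a b :
  modeled l q -> cutge G 2 -> a <> b -> cut [set a; b] -> 0 < l a -> 0 < l b ->
  exists (G' : mgraph) (q' : edge G' -> edge H),
    [/\ shift G G', cutge G' 2, #|vert G'| = #|vert G|, #|edge G'| = #|edge G| &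
        modeled (fun c => l c + (c == b) - (c == a)) q'].
Proof.
move=> MG c2 ab cab la lb; have [r [o [f [p M]]]] := MG.
have [e [ea _]] := m_surj M la; have [g [gb _]] := m_surj M lb.
have qeg : q e <> q g by rewrite ea gb.
have ceg : cut [set e; g] by apply: (cut_lift M) => //; rewrite ea gb.
have ge : g <> e by move=> E; apply: qeg; rewrite E.
(* Only the half-edge [(g, false)] moves to the new vertex, so the expansion just subdivides [g]. *)
pose v := endv g false; pose S : {set halfedge G} := [set (g, false)].
pose K := expand v S; pose e' : edge K := Some e; pose n : edge K := None; pose g' : edge K := Some g.
have SV : series_vertex (None : vert K) n g' true false.
  split=> //; first by rewrite /= /v eqxx inE eqxx.
  move=> [h|] i /=; last by case: i => //; left.
  by case: ifP => // /andP[_]; rewrite inE => /eqP[-> ->]; right.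
have [av [be [bav bbe abE valb]]] := expand_contract v S.
have M0 := modeled_transport bav bbe abE MG.
have gF : g' \notin [set n] by rewrite inE.
have [q' [M' q'n q'v]] := modeled_subdivide SV gF M0.
have q'S h : q' (Some h : edge K) = q h.
  have hF : (Some h : edge K) \notin [set n] by rewrite inE.
  have := q'v (exist _ (Some h : edge K) hF) => /= ->; congr q.
  by have [] := valb (exist _ (Some h : edge K) hF).
have K2 : cutge K 2.
  by apply: (series_cutge2 SV); apply: iso_cutge c2; apply/iso_sym/expand_iso.
have cK : cut [set e'; n].
  move/cutP: ceg => [X [_ [_ [_ _ EX]]]].
  (* The new vertex is first put on the side of [v]; switching it afterwards exchanges [g'] for
     [n]. *)
  pose X1 : {set vert K} := [set z : vert K | odflt v z \in X].
  have E1 : crossing X1 = [set e'; g'].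
    apply/setP=> -[h|]; last by rewrite !inE eqxx.
    have A i : (endv (Some h : edge K) i \in X1) = (endv h i \in X).
      by rewrite inE /=; case: ifP => //= /andP[/eqP->].
    have -> : ((Some h : edge K) \in [set e'; g']) = (h \in [set e; g]) by rewrite !inE.
    by rewrite EX (in_crossing _ _ false) !A [RHS]inE.
  have E2 : crossing (symd X1 [set (None : vert K)]) = [set e'; n].
    rewrite crossing_symd E1 (series_crossing SV); apply/setP=> h; rewrite in_set !in_set2.
    have ge2 : (g' == e') = false by apply/eqP => -[]/ge.
    case: (eqVneq h g') => [->|_]; first by rewrite ge2.
    by case: (eqVneq h e') => [->//|_]; case: (h == n).
  by rewrite -E2; apply: (@cut_crossing _ _ n); rewrite E2 !inE eqxx orbT.
have nle : endv e' false != endv e' true.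
  move/cutP: cK => [Z [_ [_ [_ _ EZ]]]]; have : e' \in crossing Z by rewrite -EZ !inE eqxx.
  by rewrite inE; apply: contraNneq => ->.
exists (contract [set e']), (fun u => q' (val u)); split.
- exists e, v, S; split; last exact: iso_refl.
  by apply: cut2_sbond => //; rewrite cards2.
- exact: contract_cutge.
- have := card_vert_contract1 nle; rewrite card_vert_expand; by case.
- have := card_edge_contract1 e'; rewrite card_edge_expand; by case.
- apply: modeled_ext (modeled_contract e' M') => // c.
  by rewrite q'S ea -q'n q'n -(q'v (exist _ g' gF)) /= q'S gb.
Qed.

(** * Classes of edges sharing 2-cuts *)

Section CutClasses.
Variable G : mgraph.

Definition same_cut (c d : edge G) := (c == d) || cut [set c; d].

Lemma same_cut_sym c d : same_cut c d = same_cut d c.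
Proof. by rewrite /same_cut eq_sym setUC. Qed.

(** Adding two 2-cuts that share [d] cancels [d]. *)
Lemma same_cut_trans c d e : same_cut c d -> same_cut d e -> same_cut c e.
Proof.
rewrite /same_cut => /orP[/eqP->//|cd] /orP[/eqP<-|de]; first by rewrite cd orbT.
have [//|ce] := eqVneq c e; rewrite /=.
have [E|ncd] := eqVneq c d; first by rewrite E.
have [E|nde] := eqVneq d e; first by rewrite -E.
move: cd de => /cutP[X [_ [_ [_ _ EX]]]] /cutP[Y [_ [_ [_ _ EY]]]].
have E : crossing (symd X Y) = [set c; e].
  rewrite crossing_symd -EX -EY; apply/setP=> h; rewrite in_set !in_set2.
  case: (eqVneq h d) => [->|_]; rewrite ?orbF /= ?orbT //.
    by rewrite eq_sym (negbTE ncd) (negbTE nde).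
  case: (eqVneq h c) => [->|_]; last by [].
  by rewrite (negbTE ce).
by rewrite -E; apply: (@cut_crossing _ _ c); rewrite E !inE eqxx.
Qed.

(** [pick] depends only on the extension of its predicate, so all edges of a class get the same
    representative; the default is never reached. *)
Definition cut_rep c := odflt c [pick d | same_cut c d].

Lemma cut_repP c : same_cut c (cut_rep c).
Proof. by rewrite /cut_rep; case: pickP => //= /(_ c); rewrite /same_cut eqxx. Qed.

Lemma cut_rep_eq c d : same_cut c d -> cut_rep c = cut_rep d.
Proof.
move=> cd; rewrite /cut_rep (eq_pick (Q := same_cut d)) => [|e].
  by case: pickP => //= /(_ d); rewrite /same_cut eqxx.
apply/idP/idP; last exact: same_cut_trans.
by apply: same_cut_trans; rewrite same_cut_sym.
Qed.

Lemma cut_rep_idem c : cut_rep (cut_rep c) = cut_rep c.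
Proof. by rewrite -(cut_rep_eq (cut_repP c)). Qed.

(** Induction on the total length off the representatives. Representatives only gain length, so they
    stay positive, as [shift_move] requires. *)
Lemma shifts_to_reps (G1 : mgraph) (l : edge G -> nat) (q : edge G1 -> edge G) :
  modeled l q -> cutge G1 2 -> (forall c, cut_rep c = c -> 0 < l c) ->
  exists (G' : mgraph) (l' : edge G -> nat) (q' : edge G' -> edge G),
    [/\ shifts G1 G', cutge G' 2, #|vert G'| = #|vert G1| /\ #|edge G'| = #|edge G1|,
        modeled l' q' & forall c, cut_rep c <> c -> l' c = 0].
Proof.
have [m] := ubnP (\sum_(c | cut_rep c != c) l c); elim: m G1 l q => // m IH G1 l q lm M c2 lr.
have [/existsP[a /andP[ra la]]|/existsPn z] := boolP [exists c, (cut_rep c != c) && (0 < l c)]; last first.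
  exists G1, l, q; split=> //; first exact/shifts_iso/iso_refl.
  move=> c /eqP rc; have := z c; rewrite rc /=; by case: (l c).
set b := cut_rep a in ra; have rb : cut_rep b = b by apply: cut_rep_idem.
have ab : a <> b by move=> E; rewrite -E eqxx in ra.
have cab : cut [set a; b] by have := cut_repP a; rewrite /same_cut -/b; case/orP=> // /eqP.
have [G2 [q2 [s2 c22 V2 E2 M2]]] := shift_move M c2 ab cab la (lr _ rb).
have [| |G' [l' [q' [s' c' [V' E'] M' z']]]] := IH _ _ _ _ M2 c22.
- have : \sum_(c | cut_rep c != c) (l c + (c == b) - (c == a)) < \sum_(c | cut_rep c != c) l c.
    rewrite (bigD1 a) //= [X in _ < X](bigD1 a) //= -addSn; apply: leq_add.
      by rewrite eqxx; case: (a =P b) => // _; rewrite addn0 subn1 prednK.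
    apply: leq_sum => c /andP[rc ca]; rewrite (negbTE ca) subn0.
    by case: (c =P b) rc => [->|_ _]; rewrite ?rb ?eqxx // addn0.
  by lia.
- move=> c rc; have lc := lr _ rc.
  case: (c =P a) => [E|_]; last by rewrite subn0; lia.
  by move: ra; rewrite -E in rc *; rewrite /b -E rc eqxx.
by exists G', l', q'; split=> //; [apply: shifts_step s2 s'|rewrite V' V2 E' E2].
Qed.

End CutClasses.

Lemma shifts_to_distillable k G : 0 < k -> 0 < #|vert G| -> cutge G 2 ->
  #|edge G| = #|vert G| + k ->
  exists G', shifts G G' /\ distillable k G'.
Proof.
move=> k0 V0 c2 EV.
have [//|G' [l [q [s c2' [V' E'] M z]]]] := shifts_to_reps (modeled_id G) c2.
exists G'; split=> //; apply: trivial_distillable; rewrite ?V' ?E' //.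
apply: (model_trivial M) => a b ab cab.
(* Two distinct edges of a 2-cut share their representative, so one of them is not a representative
   and has length 0. *)
have R : cut_rep a = cut_rep b by apply: cut_rep_eq; rewrite /same_cut cab orbT.
have [ra|/eqP/z->] := eqVneq (cut_rep a) a; last by left.
by right; apply: z; rewrite -R ra.
Qed.

(** * Assembly of (a), (b) and (c) *)

Theorem theorem5p2 (G : mgraph) (n k : nat) (hn : 1 <= n) (hk : 1 <= k)
    (hG : in_Gnm n (n + k) G) (hbl : bridgeless G) :
  [/\ has_weak_distillation_in_Dk k G <->
        (forall B : {set edge G}, sbond 2 B -> trivial_2bond B),
      exists G' : mgraph, equivalent G G' /\ has_weak_distillation_in_Dk k G'
    & ~ has_weak_distillation_in_Dk k G ->
      forall G' : mgraph, equivalent G G' -> has_weak_distillation_in_Dk k G' ->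
        forall D : mgraph, in_Dk k D ->
        forall l : edge D -> nat, chain_lengths G' l ->
          ~ balanced_lengths l /\ exists e : edge D, l e = 0].
Proof.
have [cG VG EG] := hG.
have V0 : 0 < #|vert G| by rewrite VG.
have EV : #|edge G| = #|vert G| + k by rewrite VG.
have c2 : cutge G 2.
  apply/cutgeP => X x y xX yX; rewrite ltnNge; apply/negP => X1.
  (* Deleting any one edge leaves the graph connected, which excludes empty cuts; deleting the edge
     of a 1-cut excludes bridges. *)
  have /card_gt0P[e0 _] : 0 < #|edge G| by rewrite EV; lia.
  have [E|/card_gt0P[e eX]] := posnP #|crossing X|.
    have [e eX _] := elimT (connected_crossing _ V0) (hbl e0) X x y xX yX.
    by rewrite (cards0_eq E) in_set0 in eX.
  have [e' e'X] := elimT (connected_crossing _ V0) (hbl e) X x y xX yX.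
  rewrite inE => /eqP; apply; apply/eqP.
  move: X1; rewrite (cardsD1 e) eX (cardsD1 e') in_setD1 e'X andbT.
  by case: eqP.
have c3D D : in_Dk k D -> cutge D 3 by move=> [_ /edge_connectedP[] //].
split.
- split=> [[D DD [_ [l cl]]]|tr]; last exact/distillable_has_weak_distillation/trivial_distillable.
  have [q M] := chain_lengths_modeled cl; apply: (model_trivial M) => a b /eqP ab cab.
  by have := cutge_cards (c3D _ DD) cab; rewrite cards2 ab.
- have [G' [s dG']] := shifts_to_distillable hk V0 c2 EV.
  by exists G'; split; [left|apply: distillable_has_weak_distillation].
move=> nG G' eqG _ D DD l cl; have [q M] := chain_lengths_modeled cl.
have [cD _ _ _] := DD; have c3 := c3D _ DD.
have [c lc] : exists c, l c = 0.
  apply: NNPP => nz; have lp c : 0 < l c by rewrite lt0n; apply/eqP => E; apply: nz; exists c.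
  apply: nG; have [q1 M1] : exists q1 : edge G -> edge D, modeled l q1.
    apply: (shifts_invariant (I := fun G1 => exists q1 : edge G1 -> edge D, modeled l q1)) eqG _.
    + by move=> G1 G2 I [q1 M1]; apply: iso_modeled (iso_sym I) M1.
    + by move=> G1 G2 s [q1 M1]; apply: positive_sym_shift s M1.
    + by exists q.
  exists D => //; split=> //; exists l; split; last exact: modeled_iso_weak_subdivision M1.
  by case=> // h s _; rewrite big_cons addn_gt0 lp.
split; last by exists c.
(* Next to the zero chain [c], balance bounds every length by one. *)
move=> bal; apply: nG; apply: distillable_has_weak_distillation; apply: cutge3_distillable => //.
apply: (shifts_invariant (I := fun G1 => cutge G1 3)) eqG _.
- by move=> G1 G2; apply: iso_cutge.
- exact: cutge3_sym_shift.
have [r [o [f [p Mo]]]] := M; apply: (cutge_model Mo) c3 => d.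
by have := bal d c; rewrite lc.
Qed.
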